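(* Let $\mathcal{H}_k$ be an analytic tridiagonal space corresponding to the orthonormal basis $\{f_n\}_{n\ge 0}$, where $f_n(z)=(a_n+b_nz)z^n$, $n\ge 0$. Then the Shimorin kernel $k_{M_z}$ of the shift $M_z$ on $\mathcal{H}_k$ is tridiagonal if and only if $M_z$ on $\mathcal{H}_k$ is a weighted shift or $b_0=0$.
   Context: $\mathbb{D}$ is the open unit disc, $\mathcal{O}(\mathbb{D})$ the space of analytic functions on $\mathbb{D}$. For a positive definite scalar kernel $k$ on $\mathbb{D}$, analytic in the first variable, $\mathcal{H}_k$ is its reproducing kernel Hilbert space of analytic functions, and the shift $M_z$ is $(M_zf)(w)=wf(w)$. A semi-analytic tridiagonal space is such an $\mathcal{H}_k$ with $\mathbb{C}[z]\subseteq\mathcal{H}_k\subseteq\mathcal{O}(\mathbb{D})$ for which there are complex scalars $\{a_n\}_{n\ge 0}$, $\{b_n\}_{n\ge 0}$ with $a_n\ne 0$ for all $n$, $\sup_{n}|a_n/a_{n+1}|<\infty$, $\limsup_{n}|b_n/a_{n+1}|<1$, and such that $f_n(z)=(a_n+b_nz)z^n$, $n\ge 0$, form an orthonormal basis of $\mathcal{H}_k$ (so $k(z,w)=\sum_{n\ge0}f_n(z)\overline{f_n(w)}$). These conditions ensure that $M_z$ is bounded on $\mathcal{H}_k$. It is an analytic tridiagonal space if in addition $\{|a_n/a_{n+1}|\}_{n\ge 0}$ is bounded away from zero; then $M_z$ is left-invertible. ''$M_z$ is a weighted shift'' means a weighted shift with respect to the orthonormal basis $\{f_n\}$: for every $n\ge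 0$, $M_zf_n$ is a scalar multiple of $f_{n+1}$. For a left-invertible bounded operator $T$ on a Hilbert space $\mathcal{H}$, the Shimorin left inverse is $L_T=(T^*T)^{-1}T^*$; put $\mathcal{W}=\ker T^*$ and $\Omega=\{z\in\mathbb{C}:|z|<1/r(L_T)\}$, with $r$ the spectral radius. The Shimorin kernel of $T$ is the $\mathcal{B}(\mathcal{W})$-valued kernel $k_T(z,w)=P_{\mathcal{W}}(I-zL_T)^{-1}(I-\bar wL_T^* )^{-1}|_{\mathcal{W}}$, $z,w\in\Omega$, where $P_{\mathcal{W}}$ is the orthogonal projection onto $\mathcal{W}$. A kernel with expansion $\sum_{m,n\ge 0}C_{mn}z^m\bar w^n$ about the origin is tridiagonal if $C_{mn}=0$ whenever $|m-n|\ge 2$. *)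

(* Defs.v *)
From HB Require Import structures.
From mathcomp Require Import all_boot all_order all_algebra finmap.
From mathcomp Require Import all_classical all_reals all_analysis.
From mathcomp Require Import sesquilinear complex summability.
Set Implicit Arguments.
Unset Strict Implicit.
Unset Printing Implicit Defensive.
Import Order.TTheory GRing.Theory Num.Theory.
Import numFieldNormedType.Exports.
Local Open Scope classical_set_scope.
Local Open Scope ring_scope.
Local Open Scope complex_scope.

Section Functions.
Context {R : realType}.
Implicit Types (z w : R[i]).

Definition unit_disc : set R[i] := [set z | `|z| < 1].

Definition analytic_on_disc (g : R[i] -> R[i]) : Prop :=
  forall z, unit_disc z -> derivable (g : R[i]^o -> R[i]^o) z 1.

Definition positive_definite_kernel (k : R[i] -> R[i] -> R[i]) : Prop :=
  forall (n : nat) (z c : 'I_n -> R[i]), (forall i, unit_disc (z i)) ->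
    0 <= \sum_(i < n) \sum_(j < n) Num.conj (c i) * c j * k (z i) (z j).

End Functions.

(* Operators on H are plain functions H -> H; an operator on a subspace W is a
   function H -> H of which only the restriction to W matters.  The functions
   below defined by [xget 0] return 0 where the object sought does not exist. *)
Section Operators.
Context {R : realType} {H : completeNormedModType R[i]}.
Variable dot : {dot H for Num.conj}.
Implicit Types (T A L : H -> H) (W : set H) (z w : R[i]).

(* Membership in B(W). *)
Definition bounded_op_on W A : Prop :=
  [/\ forall x, W x -> W (A x),
      forall c x y, W x -> W y -> A (c *: x + y) = c *: A x + A y
    & exists M : R[i], forall x, W x -> `|A x| <= M * `|x| ].

(* The two-sided inverse of A, when A is bijective. *)
Definition op_inv A (y : H) : H := xget 0 [set x | A x = y].

Definition adjoint T (y : H) : H :=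
  xget 0 [set u | forall x, dot (T x) y = dot x u].

Definition ortho_proj W (x : H) : H :=
  xget 0 [set u | W u /\ forall v, W v -> dot (x - u) v = 0].

Definition ker_op A : set H := [set x | A x = 0].

Definition spectrum A : set R[i] :=
  [set l | ~ exists2 S, bounded_op_on setT S &
      cancel (fun x => l *: x - A x) S /\ cancel S (fun x => l *: x - A x)].

Definition spectral_radius A : \bar R :=
  ereal_sup [set (Normc.normc l)%:E | l in spectrum A].

Definition shimorin_inverse T : H -> H :=
  op_inv (adjoint T \o T) \o adjoint T.

Definition shimorin_space T : set H := ker_op (adjoint T).

(* In \bar R, the inverse of 0 is +oo. *)
Definition shimorin_domain T : set R[i] :=
  [set z | ((Normc.normc z)%:E <
            (spectral_radius (shimorin_inverse T))^-1)%E].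

Definition shimorin_kernel T z w : H -> H :=
  let L := shimorin_inverse T in
  ortho_proj (shimorin_space T)
  \o op_inv (fun x => x - z *: L x)
  \o op_inv (fun x => x - Num.conj w *: adjoint L x).

(* K(z, w) = \sum_(m, n) C m n z^m conj(w)^n in the operator norm of B(W), for
   (z, w) in a neighbourhood of the origin contained in Om x Om.  Double series
   are summed unconditionally: [totally] is the filter of the finite sets of
   indices, directed by inclusion. *)
Definition kernel_expansion W (Om : set R[i])
    (K : R[i] -> R[i] -> H -> H) (C : nat -> nat -> H -> H) : Prop :=
  (forall m n, bounded_op_on W (C m n)) /\
  exists2 d : R[i], 0 < d &
    forall z w, `|z| < d -> `|w| < d ->
    [/\ Om z, Om w &
      forall e : R[i], 0 < e ->
      \forall F \near totally, forall x, W x ->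
        `| K z w x
           - partial_sum (fun p : nat * nat =>
               (z ^+ p.1 * Num.conj w ^+ p.2) *: C p.1 p.2 x) F |
        <= e * `|x| ].

Definition tridiagonal_kernel W (Om : set R[i])
    (K : R[i] -> R[i] -> H -> H) : Prop :=
  exists2 C, kernel_expansion W Om K C &
    forall m n, (2 <= `|m%:Z - n%:Z|)%N -> forall x, W x -> C m n x = 0.

End Operators.

Section TridiagonalSpaces.
Context {R : realType} {H : completeNormedModType R[i]}.
Variables (dot : {dot H for Num.conj}) (ev : H -> R[i] -> R[i]).
Variables (k : R[i] -> R[i] -> R[i]) (a b : nat -> R[i]) (f : nat -> H).

(* (H, dot) is a Hilbert space whose elements g are identified with the
   functions [ev g] on the disc (values off the disc are irrelevant), and k is
   its reproducing kernel.  Positive definiteness of k already follows from the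
   reproducing property. *)
Record is_rkhs : Prop := IsRkhs {
  rkhs_norm : forall g : H, `|g| ^+ 2 = dot g g;
  rkhs_ev_linear : forall (c : R[i]) (g h : H) w, unit_disc w ->
    ev (c *: g + h) w = c * ev g w + ev h w;
  rkhs_ev_inj : forall g h : H,
    (forall w, unit_disc w -> ev g w = ev h w) -> g = h;
  rkhs_kernel_posdef : positive_definite_kernel k;
  rkhs_kernel_analytic : forall w, unit_disc w -> analytic_on_disc (k^~ w);
  rkhs_reproducing : forall w, unit_disc w -> exists kw : H,
    (forall z, unit_disc z -> ev kw z = k z w) /\
    (forall g, dot g kw = ev g w) }.

Definition orthonormal_basis : Prop :=
  (forall m n, dot (f m) (f n) = (m == n)%:R) /\
  (forall g : H, series (fun n => dot g (f n) *: f n) @ \oo --> g).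

Record semi_analytic_tridiagonal_space : Prop := SemiAnalyticTridiagonal {
  sat_rkhs : is_rkhs;
  sat_analytic : forall g : H, analytic_on_disc (ev g);
  sat_poly : forall p : {poly R[i]}, exists g : H,
    forall w, unit_disc w -> ev g w = p.[w];
  sat_a_neq0 : forall n, a n != 0;
  sat_ratio_bounded :
    has_ubound (range (fun n => Normc.normc (a n / a n.+1)));
  sat_limsup : (limn_esup (fun n =>
    (Normc.normc (b n / a n.+1))%:E) < 1)%E;
  sat_basis_ev : forall n w, unit_disc w ->
    ev (f n) w = (a n + b n * w) * w ^+ n;
  sat_basis : orthonormal_basis }.

Definition analytic_tridiagonal_space : Prop :=
  semi_analytic_tridiagonal_space /\
  exists2 e : R, 0 < e &
    forall n, e <= Normc.normc (a n / a n.+1).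

(* M_z: multiplication by the coordinate function, as an operator on H. *)
Definition shift_op (g : H) : H :=
  xget 0 [set h | forall w, unit_disc w -> ev h w = w * ev g w].

Definition is_weighted_shift (T : H -> H) : Prop :=
  forall n, exists c : R[i], T (f n) = c *: f n.+1.

End TridiagonalSpaces.

(* Main.v *)
Require Import Defs.
From HB Require Import structures.
From mathcomp Require Import all_boot all_order all_algebra finmap.
From mathcomp Require Import all_classical all_reals all_analysis.
From mathcomp Require Import sesquilinear complex summability.
From mathcomp Require Import ring lra zify.
Import Order.TTheory GRing.Theory Num.Theory.
Import numFieldNormedType.Exports.
Local Open Scope classical_set_scope.
Local Open Scope ring_scope.
Local Open Scope complex_scope.
Set Implicit Arguments.
Unset Strict Implicit.
Unset Printing Implicit Defensive.

(** The space is, up to equivalence of norms, a weighted l2 space of power series.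
    The Taylor coefficients at the origin of the function of [x] are
    [t_n = a_n <x, f_n> + b_(n-1) <x, f_(n-1)>].  As [limsup |b_n / a_(n+1)| < 1],
    this recursion can be solved for the coordinates, and the sum of the
    [|<x, f_n>|^2] and that of the [|t_n / a_n|^2] control each other
    ([taylor_bound], [taylor_synthesis]).  On Taylor coefficients the shift [T]
    moves every term one place up.  The bounds of [|a_n / a_(n+1)|] from above and
    from below make it and the backward shift bounded ([shift_op_spec],
    [backward_shift]).  Hence [ker T^*] is the line of [f_0], and the Shimorin
    inverse [L] kills [f_0] and shifts Taylor coefficients backwards on its
    orthogonal complement ([shimorin_spaceP], [shimorin_inverse_spec]).

    On the line of [f_0] operators are scalars, and the Neumann series of
    [(I - z L)^-1] and of its adjoint expand the kernel near the origin with the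
    coefficients [X_mn = <L^m L^*n f_0, f_0>].  Such an expansion is unique
    ([double_series_unique]), so the kernel is tridiagonal exactly when [X_mn]
    vanishes for [|m - n| >= 2] ([tridiagonal_kernelP]).

    Put [beta = b_0 / a_0].  As [L] removes the component on [f_0] before it
    shifts, [a_0 <L^(m+1) x, f_0> = t_(m+1) - beta a_0 <L^m x, f_0>] ([iter_L_S]).
    If [beta = 0], then [a_0 <L^m x, f_0>] is [t_m], which involves two adjacent
    coordinates of [x], and the matrix [X] is tridiagonal.  If [T] is a weighted
    shift, that is, if [b_j = beta a_j] for all [j], the recursion collapses to
    [a_0 <L^m x, f_0> = a_m <x, f_m>], and [X] is even diagonal.
    Conversely, let [beta] be nonzero, let [X] be tridiagonal and suppose that
    [b_i = beta a_i] for all [i < j].  The recursion has collapsed up to rank [j],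
    so that [X_(j, j+2) = 0] means that [<L^(j+2) f_j, f_0> = 0].  But the
    recursion also gives [a_0 <L^(j+2) f_j, f_0> = - beta (b_j - beta a_j)], so
    [b_j = beta a_j] as well ([defect_eq0]). *)

(** * Real-valued norms and convergence *)

Section RealNorm.
Context {R : realType}.

(** Norms over [R[i]] take values in [R[i]], where the order is only partial; all
    the estimates below are made in [R]. *)
Definition rnorm {V : normedZmodType R[i]} (x : V) : R := complex.Re `|x|.

Implicit Types V : normedZmodType R[i].

Lemma rnormE V (x : V) : `|x| = real_complex R (rnorm x).
Proof. by rewrite /rnorm RRe_real// normr_real. Qed.

Lemma rnorm_normc (c : R[i]) : rnorm c = Normc.normc c.
Proof. by []. Qed.

Lemma rnorm_ge0 V (x : V) : 0 <= rnorm x.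
Proof. by rewrite -lecR -rnormE normr_ge0. Qed.

Lemma ler_rnormD V (x y : V) : rnorm (x + y) <= rnorm x + rnorm y.
Proof. by rewrite -lecR rmorphD/= -!rnormE ler_normD. Qed.

Lemma rnormN V (x : V) : rnorm (- x) = rnorm x.
Proof. by rewrite /rnorm normrN. Qed.

Lemma rdistC V (x y : V) : rnorm (x - y) = rnorm (y - x).
Proof. by rewrite -rnormN opprB. Qed.

Lemma ler_rdistD V (y x z : V) : rnorm (x - z) <= rnorm (x - y) + rnorm (y - z).
Proof. by have := ler_rnormD (x - y) (y - z); rewrite addrA subrK. Qed.

Lemma rnorm0 V : rnorm (0 : V) = 0.
Proof. by rewrite /rnorm normr0. Qed.

Lemma rnorm0_eq0 V (x : V) : rnorm x = 0 -> x = 0.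
Proof. by move=> x0; apply/eqP; rewrite -normr_eq0 rnormE x0. Qed.

Lemma rnormM (c d : R[i]) : rnorm (c * d) = rnorm c * rnorm d.
Proof. by apply: complexI; rewrite rmorphM/= -!rnormE normrM. Qed.

Lemma rnormZ (V : normedModType R[i]) (c : R[i]) (x : V) :
  rnorm (c *: x) = rnorm c * rnorm x.
Proof. by apply: complexI; rewrite rmorphM/= -!rnormE normrZ. Qed.

Lemma rnormX (c : R[i]) n : rnorm (c ^+ n) = rnorm c ^+ n.
Proof. by apply: complexI; rewrite rmorphXn/= -!rnormE normrX. Qed.

Lemma rnormV (c : R[i]) : rnorm c^-1 = (rnorm c)^-1.
Proof. by apply: complexI; rewrite fmorphV -!rnormE normfV. Qed.

Lemma rnorm_conj (c : R[i]) : rnorm (Num.conj c) = rnorm c.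
Proof. by rewrite /rnorm norm_conjC. Qed.

Lemma rnorm_real (x : R) : 0 <= x -> rnorm (real_complex R x) = x.
Proof. by move=> x0; apply: complexI; rewrite -rnormE ger0_norm// ler0c. Qed.

Lemma rnorm1 : rnorm (1 : R[i]) = 1.
Proof. by rewrite /rnorm normr1. Qed.

Lemma rnorm_nat n : rnorm (n%:R : R[i]) = n%:R.
Proof. by apply: complexI; rewrite -rnormE normr_nat rmorph_nat. Qed.

Lemma ler_rnorm_sum V (I : Type) (r : seq I) (P : pred I) (F : I -> V) :
  rnorm (\sum_(i <- r | P i) F i) <= \sum_(i <- r | P i) rnorm (F i).
Proof.
elim/big_ind2: _ => [|x a y b xa yb|//]; first by rewrite rnorm0.
by rewrite (le_trans (ler_rnormD _ _))// lerD.
Qed.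

Lemma posc_real (e : R[i]) : 0 < e -> exists2 r : R, 0 < r & e = real_complex R r.
Proof.
move=> e0; exists (complex.Re e); last by rewrite RRe_real// gtr0_real.
by rewrite -ltcR RRe_real// gtr0_real.
Qed.

Lemma cvg_rnormP (V : normedModType R[i]) (u : nat -> V) (l : V) :
  (u @ \oo --> l) <->
  (forall e : R, 0 < e -> exists N, forall n, (N <= n)%N -> rnorm (u n - l) <= e).
Proof.
split=> [/cvgrPdistC_le ul e e0|ul].
  have [|N _ NP] := ul (real_complex R e); first by rewrite ltcR.
  by exists N => n /NP; rewrite /= rnormE lecR.
apply/cvgrPdistC_le => e /posc_real[r r0 ->].
have [N NP] := ul _ r0; exists N => // n /= /NP.
by rewrite rnormE lecR.
Qed.

Lemma cauchy_rnorm (V : completeNormedModType R[i]) (u : nat -> V) :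
  (forall e : R, 0 < e ->
    exists N, forall n, (N <= n)%N -> rnorm (u n - u N) <= e) ->
  exists l : V, u @ \oo --> l.
Proof.
move=> cu; suff /cauchy_cvgP/cvg_ex[l ul] : cauchy (u @ \oo) by exists l.
apply: cauchy_exP => e /posc_real[r r0 ->].
have r20 : 0 < r / 2 by rewrite divr_gt0.
have [N NP] := cu _ r20; exists (u N), N => // n /= /NP un.
rewrite -ball_normE /= rnormE ltcR rdistC (le_lt_trans un)//.
by rewrite ltr_pdivrMr// ltr_pMr// ltr1n.
Qed.

Lemma eq0_small (x A : R) : 0 <= x -> 0 <= A ->
  (forall e, 0 < e -> x <= A * e) -> x = 0.
Proof.
move=> x0 A0 xe; apply/eqP; rewrite eq_le x0 andbT leNgt; apply/negP => xp.
have A1 : 0 < A + 1 by lra.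
pose y := x / (A + 1); have y0 : 0 < y by rewrite divr_gt0.
have yx : y * (A + 1) = x by rewrite divfK// gt_eqF.
have := xe (y / 2); rewrite divr_gt0// => /(_ isT).
have : 0 <= A * y by rewrite mulr_ge0// ltW.
rewrite mulrA; move: yx; rewrite mulrDr mulr1 (mulrC y).
lra.
Qed.

Lemma expr_half_small (e : R) : 0 < e -> exists N, 2^-1 ^+ N <= e.
Proof.
move=> e0; have := @cvg_geometric R 1 2^-1.
rewrite ger0_norm ?invr_ge0// invf_lt1// ltr1n.
move=> /(_ isT)/cvgrPdist_le/(_ _ e0)[N _ /(_ N)/=].
rewrite leqnn sub0r normrN mul1r ger0_norm ?exprn_ge0 ?invr_ge0//.
by move=> /(_ isT) ?; exists N.
Qed.

Lemma cvg_rnorm_le (V : normedModType R[i]) (u : nat -> V) (l : V) (B : R) :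
  u @ \oo --> l -> (forall n, rnorm (u n) <= B) -> rnorm l <= B.
Proof.
move=> /cvg_rnormP ul uB; rewrite leNgt; apply/negP => Bl.
have [|N /(_ N (leqnn _)) NP] := ul ((rnorm l - B) / 2); first lra.
have := ler_rnormD (u N) (l - u N); rewrite addrC subrK rdistC.
by have := uB N; lra.
Qed.

Lemma cvg_rnorm_unique (V : normedModType R[i]) (u : nat -> V) (l l' : V) :
  u @ \oo --> l -> u @ \oo --> l' -> l = l'.
Proof.
move=> /cvg_rnormP ul /cvg_rnormP ul'; apply/eqP; rewrite -subr_eq0; apply/eqP.
apply: rnorm0_eq0; apply: (@eq0_small _ 2) => //; first exact: rnorm_ge0.
move=> e e0; have [N NP] := ul _ e0; have [M MP] := ul' _ e0.
have := NP (maxn N M) (leq_maxl _ _); have := MP (maxn N M) (leq_maxr _ _).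
have := ler_rdistD (u (maxn N M)) l l'; rewrite (rdistC l (u _)); lra.
Qed.

End RealNorm.

(** * Hilbert spaces and Neumann series *)

Section Hilbert.
Context {R : realType} {H : completeNormedModType R[i]}.
Variable dot : {dot H for Num.conj}.
Hypothesis dot_norm : forall g : H, `|g| ^+ 2 = dot g g.
Implicit Types (x y : H) (c : R[i]).

Lemma dot_sym x y : dot x y = Num.conj (dot y x).
Proof. by rewrite hermC expr0 mul1r. Qed.

Lemma dot_rnorm x : dot x x = real_complex R (rnorm x ^+ 2).
Proof. by rewrite -dot_norm rnormE rmorphXn. Qed.

Lemma rnorm_sqrB_orth x y : dot x y = 0 ->
  rnorm (x - y) ^+ 2 = rnorm x ^+ 2 + rnorm y ^+ 2.
Proof. by move=> xy; apply: complexI; rewrite rmorphD/= -!dot_rnorm hnormBd. Qed.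

(** Pythagoras' theorem for [x = (x - t *: y) + t *: y], where [t *: y] is the
    projection of [x] on the line of [y]. *)
Lemma dot_CauchySchwarz x y : rnorm (dot x y) <= rnorm x * rnorm y.
Proof.
have [->|y0] := eqVneq y 0.
  by rewrite linear0r rnorm0 mulr_ge0// rnorm_ge0.
have yn : 0 < rnorm y.
  rewrite lt_def rnorm_ge0 andbT; apply: contra y0 => /eqP y0.
  by apply/eqP; apply: rnorm0_eq0.
set d := dot x y; pose t := d / dot y y.
have ty : rnorm (t *: y) = rnorm d / rnorm y.
  rewrite rnormZ /t rnormM rnormV dot_rnorm rnorm_real ?sqr_ge0//.
  by rewrite expr2 invfM mulrA divfK// gt_eqF.
have yy0 : dot y y != 0.
  rewrite dot_rnorm -(rmorph0 (real_complex R)) (inj_eq (@complexI _)).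
  by rewrite expf_neq0 ?gt_eqF.
have orth : dot (x - t *: y) (- (t *: y)) = 0.
  by rewrite linearNr linearZr_LR/= linearBl linearZl_LR/= /t divfK// subrr mulr0 oppr0.
have := rnorm_sqrB_orth orth; rewrite opprK rnormN.
rewrite subrK ty => e.
have : (rnorm d / rnorm y) ^+ 2 <= rnorm x ^+ 2 by rewrite e lerDr sqr_ge0.
by rewrite ler_sqr ?nnegrE ?divr_ge0 ?rnorm_ge0// ler_pdivrMr.
Qed.

Lemma cvg_dotl (u : nat -> H) l y : u @ \oo --> l ->
  forall e : R, 0 < e ->
  exists N, forall n, (N <= n)%N -> rnorm (dot (u n) y - dot l y) <= e.
Proof.
move=> /cvg_rnormP ul e e0.
have y1 : 0 < rnorm y + 1 by rewrite ltr_wpDl ?rnorm_ge0.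
have [|N NP] := ul (e / (rnorm y + 1)); first by rewrite divr_gt0.
exists N => n /NP un; rewrite -linearBl (le_trans (dot_CauchySchwarz _ _))//.
rewrite ler_pdivlMr// in un; apply: le_trans un.
by rewrite ler_wpM2l ?rnorm_ge0// lerDl.
Qed.

Lemma cvg_dotl_const (u : nat -> H) l y c N : u @ \oo --> l ->
  (forall n, (N <= n)%N -> dot (u n) y = c) -> dot l y = c.
Proof.
move=> ul uc; apply/eqP; rewrite -subr_eq0; apply/eqP; apply: rnorm0_eq0.
apply: (@eq0_small _ _ 1); rewrite ?rnorm_ge0// => e e0; rewrite mul1r.
have [M MP] := @cvg_dotl _ _ y ul _ e0.
have := MP (maxn N M) (leq_maxr _ _).
by rewrite uc ?leq_maxl// rdistC.
Qed.

Record bounded_linear (A : H -> H) (M : R) : Prop := BoundedLinear {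
  bl_ge0 : 0 <= M;
  bl_linear : forall c x y, A (c *: x + y) = c *: A x + A y;
  bl_bound : forall x, rnorm (A x) <= M * rnorm x }.

Section BoundedLinear.
Variables (A : H -> H) (M : R).
Hypothesis AM : bounded_linear A M.

Lemma blD x y : A (x + y) = A x + A y.
Proof. by have := bl_linear AM 1 x y; rewrite !scale1r. Qed.

Lemma bl0 : A 0 = 0.
Proof. by apply: (addrI (A 0)); rewrite -blD !addr0. Qed.

Lemma blZ c x : A (c *: x) = c *: A x.
Proof. by have := bl_linear AM c x 0; rewrite bl0 !addr0. Qed.

Lemma blB x y : A (x - y) = A x - A y.
Proof. by rewrite blD -scaleN1r blZ scaleN1r. Qed.

Lemma bl_iter n : bounded_linear (iter n A) (M ^+ n).
Proof.
have M0 := bl_ge0 AM; split=> [|c x y|x]; first exact: exprn_ge0.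
  by elim: n => //= n ->; rewrite (bl_linear AM).
elim: n => [|n IH] /=; first by rewrite mul1r.
by rewrite (le_trans (bl_bound AM _))// exprS -mulrA ler_wpM2l.
Qed.

End BoundedLinear.

Section NeumannSeries.
Variables (A : H -> H) (M : R).
Hypothesis AM : bounded_linear A M.

Section Neumann.
Variable c : R[i].
Hypothesis cM : rnorm c * M <= 2^-1.

Lemma neumann_contraction x : rnorm (c *: A x) <= 2^-1 * rnorm x.
Proof.
rewrite rnormZ (le_trans (ler_wpM2l (rnorm_ge0 _) (bl_bound AM _)))//.
by rewrite mulrA ler_wpM2r// rnorm_ge0.
Qed.

Lemma neumann_bound x : rnorm x <= 2 * rnorm (x - c *: A x).
Proof.
have := ler_rnormD (x - c *: A x) (c *: A x); rewrite subrK.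
by have := neumann_contraction x; lra.
Qed.

Lemma neumann_unique x x' : x - c *: A x = x' - c *: A x' -> x = x'.
Proof.
move=> e; apply/eqP; rewrite -subr_eq0; apply/eqP; apply: rnorm0_eq0.
apply/eqP; rewrite eq_le rnorm_ge0 andbT (le_trans (neumann_bound _))//.
suff -> : x - x' - c *: A (x - x') = 0 by rewrite rnorm0 mulr0.
move/eqP: e; rewrite -subr_eq0 => /eqP <-.
by rewrite (blB AM) scalerBr !opprB addrACA [RHS]addrACA (addrC (- x')).
Qed.

(** Picard iteration of the contraction [x |-> y + c *: A x]. *)
Lemma neumann_exists y : exists x, x - c *: A x = y.
Proof.
pose u n := iter n (fun x => y + c *: A x) y; pose D := rnorm (u 1%N - u 0%N).
have uS n : u n.+1 = y + c *: A (u n) by [].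
have u1 n : rnorm (u n.+1 - u n) <= D * 2^-1 ^+ n.
  elim: n => [|n IH]; first by rewrite mulr1.
  rewrite 2!uS opprD addrACA subrr add0r -scalerBr -(blB AM).
  by rewrite (le_trans (neumann_contraction _))// exprS mulrCA ler_wpM2l// invr_ge0.
(* The tail of the geometric series is carried along, to make the induction
   on [k] go through. *)
have un N k : rnorm (u (N + k)%N - u N) + 2 * D * 2^-1 ^+ (N + k)
              <= 2 * D * 2^-1 ^+ N.
  elim: k => [|k IH]; first by rewrite addn0 subrr rnorm0 add0r.
  rewrite addnS; have := ler_rdistD (u (N + k)%N) (u (N + k).+1) (u N).
  have := u1 (N + k)%N; rewrite exprS; lra.
have D0 : 0 <= D by exact: rnorm_ge0.
have [e e0|l ul] := @cauchy_rnorm _ _ u.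
  have D1 : 0 < 2 * D + 1 by lra.
  have [|N NP] := @expr_half_small R (e / (2 * D + 1)); first by rewrite divr_gt0.
  exists N => n Nn; have := un N (n - N)%N; rewrite subnKC//.
  have h0 k : 0 <= 2^-1 ^+ k :> R by rewrite exprn_ge0// invr_ge0.
  have := mulr_ge0 D0 (h0 n).
  rewrite ler_pdivlMr// in NP; have := h0 N; lra.
exists l; apply/eqP; rewrite -subr_eq0; apply/eqP; apply: rnorm0_eq0.
apply: (@eq0_small _ _ 2); rewrite ?rnorm_ge0// => e e0.
move/cvg_rnormP: ul => /(_ _ e0)[N NP].
have -> : l - c *: A l - y = - (u N.+1 - l) + c *: A (u N - l).
  by rewrite uS (blB AM) scalerBr opprB opprD !addrA subrK addrAC.
rewrite (le_trans (ler_rnormD _ _))// rnormN.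
have := NP _ (leqnn N); have := NP _ (leqnSn N).
by have := neumann_contraction (u N - l); lra.
Qed.

Lemma op_inv_neumannK y : let x := op_inv (fun x => x - c *: A x) y in
  x - c *: A x = y.
Proof. exact: (xgetPex _ (neumann_exists y)). Qed.

(** The remainder telescopes to [c ^+ N *: iter N A x]. *)
Lemma neumann_remainder x N :
  rnorm (x - \sum_(n < N) c ^+ n *: iter n A (x - c *: A x)) <=
  2^-1 ^+ N * rnorm x.
Proof.
have -> : x - \sum_(n < N) c ^+ n *: iter n A (x - c *: A x) = c ^+ N *: iter N A x.
  elim: N => [|N IH]; first by rewrite big_ord0 subr0 scale1r.
  rewrite big_ord_recr/= opprD addrA IH.
  rewrite (blB (bl_iter AM N)) (blZ (bl_iter AM N)) scalerBr opprB addrC subrK.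
  by rewrite scalerA -exprSr -iterSr.
rewrite rnormZ rnormX.
have [M0 _ AN] := bl_iter AM N.
rewrite (le_trans (ler_wpM2l _ (AN _))) ?exprn_ge0 ?rnorm_ge0//.
rewrite mulrA -exprMn ler_wpM2r ?rnorm_ge0// lerXn2r// nnegrE.
  by rewrite mulr_ge0 ?rnorm_ge0// (bl_ge0 AM).
by rewrite invr_ge0.
Qed.

End Neumann.

(** Beyond [2 * M] the Neumann series of [A / l] inverts [l - A]. *)
Lemma spectrum_bound l : 0 < M -> spectrum A l -> Normc.normc l <= 2 * M.
Proof.
move=> M0 lA; rewrite leNgt; apply/negP => lM; apply: lA.
have l0 : 0 < rnorm l by rewrite (lt_trans _ lM)// mulr_gt0.
have lN0 : l != 0 by apply: contraTneq l0 => ->; rewrite rnorm0 ltxx.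
have cM : rnorm l^-1 * M <= 2^-1.
  rewrite rnormV mulrC ler_pdivrMr// mulrC ler_pdivlMr// mulrC.
  exact: ltW.
pose N := op_inv (fun x => x - l^-1 *: A x).
have NK y : N y - l^-1 *: A (N y) = y := op_inv_neumannK cM y.
exists (fun x => l^-1 *: N x); last first.
  split=> x.
    apply: (neumann_unique cM); rewrite (blZ AM) -scalerBr NK.
    by rewrite scalerBr scalerA mulVf// scale1r.
  by rewrite scalerA mulfV// scale1r (blZ AM) NK.
split=> // [c x y _ _|].
  rewrite scalerA mulrC -scalerA -scalerDr; congr (_ *: _).
  apply: (neumann_unique cM); rewrite NK (bl_linear AM) scalerDr opprD addrACA.
  by rewrite NK scalerA mulrC -scalerA -scalerBr NK.
exists (real_complex R (rnorm l^-1 * 2)) => x _.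
rewrite !rnormE -rmorphM lecR rnormZ -mulrA ler_wpM2l ?rnorm_ge0//.
by rewrite (le_trans (neumann_bound cM _))// NK.
Qed.

(** The kernel of [A] puts [0] into the spectrum, so that the spectral radius
    is not the supremum of the empty set. *)
Lemma spectral_radius_inv_gt x (r : R) : 0 < M -> x != 0 -> A x = 0 ->
  r < (2 * M)^-1 -> (r%:E < (spectral_radius A)^-1)%E.
Proof.
move=> M0 x0 Ax0 rM.
have sr0 : (0 <= spectral_radius A)%E.
  apply: ereal_sup_ubound; exists 0; last by rewrite -rnorm_normc rnorm0.
  move=> [S [_ S_lin _] [SK _]].
  have S0 : S 0 = 0.
    by apply: (addrI (S 0)); have := S_lin 1 0 0 I I; rewrite !scale1r !addr0.
  by move: x0; rewrite -(SK x) scale0r Ax0 subr0 S0 eqxx.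
have srM : (spectral_radius A <= (2 * M)%:E)%E.
  by apply: ge_ereal_sup => _ [l lA <-]; rewrite lee_fin spectrum_bound.
have M20 : 0 < 2 * M by rewrite mulr_gt0.
apply: (@lt_le_trans _ _ ((2 * M)%:E^-1)%E).
  by rewrite inver gt_eqF// lte_fin.
by rewrite lee_pV2// inE// lee_fin ltW.
Qed.

End NeumannSeries.
End Hilbert.

(** * Orthonormal bases and adjoints *)

Section OrthonormalBasis.
Context {R : realType} {H : completeNormedModType R[i]}.
Variable dot : {dot H for Num.conj}.
Hypothesis dot_norm : forall g : H, `|g| ^+ 2 = dot g g.
Variable f : nat -> H.
Hypothesis f_basis : orthonormal_basis dot f.
Implicit Types (x y : H) (c : nat -> R[i]).

Lemma dot_basis m n : dot (f m) (f n) = (m == n)%:R.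
Proof. exact: f_basis.1. Qed.

Lemma rnorm_basis n : rnorm (f n) = 1.
Proof.
apply/eqP; rewrite -(@eqrXn2 _ 2)// ?rnorm_ge0// expr1n.
by rewrite -(inj_eq (@complexI _)) -(dot_rnorm dot_norm) dot_basis eqxx.
Qed.

Definition comb c m n : H := \sum_(m <= i < n) c i *: f i.

Lemma dot_combl c m n y : dot (comb c m n) y = \sum_(m <= i < n) c i * dot (f i) y.
Proof.
rewrite /comb; elim/big_ind2: _ => [|x a x' a' <- <-|i _].
- by rewrite linear0l.
- by rewrite linearDl.
- by rewrite linearZl_LR.
Qed.

Lemma dot_comb_basis c m n k : dot (comb c m n) (f k) = if (m <= k < n)%N then c k else 0.
Proof.
rewrite dot_combl; case: ifP => [kmn|kmn].
  rewrite (bigD1_seq k) ?mem_index_iota ?iota_uniq//= dot_basis eqxx mulr1.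
  by rewrite big1 ?addr0// => i /negPf ik; rewrite dot_basis ik mulr0.
rewrite big_nat_cond big1// => i /andP[imn _].
by rewrite dot_basis; case: eqP => [ik|_]; [rewrite -ik imn in kmn|rewrite mulr0].
Qed.

Lemma sqr_rnorm_comb c m n : rnorm (comb c m n) ^+ 2 = \sum_(m <= i < n) rnorm (c i) ^+ 2.
Proof.
apply: complexI; rewrite -(dot_rnorm dot_norm) dot_combl rmorph_sum/=.
apply: eq_big_nat => i imn; rewrite dot_sym dot_comb_basis imn.
by rewrite -normCK rnormE rmorphXn.
Qed.

Lemma comb_subl c m n : (m <= n)%N -> comb c 0 n - comb c 0 m = comb c m n.
Proof. by move=> mn; rewrite /comb (big_cat_nat _ mn)//= addrAC subrr add0r. Qed.

Lemma basis_cvg x : (fun n => comb (fun i => dot x (f i)) 0 n) @ \oo --> x.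
Proof. exact: f_basis.2. Qed.

Lemma basis_ext x y : (forall n, dot x (f n) = dot y (f n)) -> x = y.
Proof.
move=> xy; apply: (cvg_rnorm_unique (@basis_cvg x)).
have -> : (fun i => dot x (f i)) = (fun i => dot y (f i)) by exact/funext.
exact: basis_cvg.
Qed.

Lemma Bessel x N : \sum_(0 <= i < N) rnorm (dot x (f i)) ^+ 2 <= rnorm x ^+ 2.
Proof.
pose S := comb (fun i => dot x (f i)) 0 N.
have xS : dot (x - S) S = 0.
  rewrite dot_sym dot_combl big_nat_cond big1 ?rmorph0// => i /andP[iN _].
  by rewrite (dot_sym _ (f i)) linearBl/= dot_comb_basis iN subrr rmorph0 mulr0.
have xS' : dot (x - S) (- S) = 0 by rewrite linearNr/= xS oppr0.
have := rnorm_sqrB_orth dot_norm xS'; rewrite opprK subrK rnormN => ->.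
by rewrite sqr_rnorm_comb lerDr sqr_ge0.
Qed.

Lemma Parseval_le x (V : R) : 0 <= V ->
  (forall N, \sum_(0 <= i < N) rnorm (dot x (f i)) ^+ 2 <= V) -> rnorm x ^+ 2 <= V.
Proof.
move=> V0 xV; have : rnorm x <= Num.sqrt V.
  apply: (cvg_rnorm_le (@basis_cvg x)) => n.
  by rewrite -(@ler_sqr R) ?nnegrE ?rnorm_ge0 ?sqrtr_ge0// sqr_sqrtr// sqr_rnorm_comb.
by move=> xs; rewrite -(sqr_sqrtr V0) ler_sqr ?nnegrE ?rnorm_ge0 ?sqrtr_ge0.
Qed.

(** The partial sums are Cauchy because those of the [rnorm (c i) ^+ 2] are: these
    increase to their supremum. *)
Lemma Riesz_Fischer c (V : R) :
  (forall N, \sum_(0 <= i < N) rnorm (c i) ^+ 2 <= V) ->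
  exists x, forall n, dot x (f n) = c n.
Proof.
move=> cV; pose W N := \sum_(0 <= i < N) rnorm (c i) ^+ 2.
have supW : has_sup (range W).
  by split; [exists (W 0%N), 0%N|exists V => _ [n _ <-]; exact: cV].
have [e e0|x cx] := @cauchy_rnorm _ _ (comb c 0).
  have [_ [N _ <-] WN] := sup_adherent (exprn_gt0 2 e0) supW.
  exists N => n Nn; rewrite comb_subl//.
  rewrite -(@ler_sqr R) ?nnegrE ?rnorm_ge0 ?(ltW e0)// sqr_rnorm_comb.
  have : W n <= sup (range W) by apply: ub_le_sup; [case: supW|exists n].
  rewrite /W (big_cat_nat _ Nn)//= -/(W N); lra.
exists x => n; apply: (@cvg_dotl_const _ _ _ dot_norm _ _ _ _ n.+1 cx) => m nm.
by rewrite dot_comb_basis leq0n nm.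
Qed.

Section Adjoint.
Variables (A : H -> H) (M : R).
Hypothesis AM : bounded_linear A M.

Lemma bl_comb c m n : A (comb c m n) = \sum_(m <= i < n) c i *: A (f i).
Proof.
rewrite /comb; elim/big_ind2: _ => [|x a x' a' <- <-|i _].
- exact: bl0 AM.
- exact: blD AM _ _.
- exact: blZ AM _ _.
Qed.

(** Riesz representation of [x |-> dot (A x) y].  The coordinates [c i] of the
    representing vector are forced; evaluating the functional at their truncation
    [S] gives the sum [W] of the squares of its coordinates, and boundedness turns
    this into [W <= rnorm S * (M * rnorm y)], where [rnorm S ^+ 2 = W]. *)
Lemma adjoint_exists y : exists u, forall x, dot (A x) y = dot x u.
Proof.
have M0 := bl_ge0 AM.
pose c i := dot y (A (f i)); pose V := (M * rnorm y) ^+ 2.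
have [N|u uc] := @Riesz_Fischer c V.
  set W := \sum_(0 <= i < N) _; pose S := comb c 0 N.
  have W0 : 0 <= W by apply: sumr_ge0 => i _; exact: sqr_ge0.
  have WS : dot (A S) y = real_complex R W.
    rewrite bl_comb rmorph_sum/=.
    have -> : dot (\sum_(0 <= i < N) c i *: A (f i)) y =
              \sum_(0 <= i < N) c i * dot (A (f i)) y.
      elim/big_ind2: _ => [|x a x' a' <- <-|i _].
      - by rewrite linear0l.
      - by rewrite linearDl.
      - by rewrite linearZl_LR.
    by apply: eq_bigr => i _; rewrite (dot_sym _ (A _)) -normCK rnormE rmorphXn.
  have := dot_CauchySchwarz dot_norm (A S) y; rewrite WS rnorm_real// => WS'.
  have {}WS' : W <= rnorm S * (M * rnorm y).
    by rewrite (le_trans WS')// mulrA ler_wpM2r ?rnorm_ge0// mulrC (bl_bound AM).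
  have My0 : 0 <= M * rnorm y by rewrite mulr_ge0// rnorm_ge0.
  have : W ^+ 2 <= W * V.
    have SW : rnorm S ^+ 2 = W by exact: sqr_rnorm_comb.
    by rewrite -[X in X * V]SW -exprMn lerXn2r// nnegrE ?mulr_ge0 ?rnorm_ge0.
  have [->|Wn0] := eqVneq W 0; first by rewrite /V sqr_ge0.
  by rewrite expr2 ler_pM2l// lt_def Wn0.
exists u => x.
have uB : dot (A x) y - dot x u = 0; last by move/eqP: uB; rewrite subr_eq0 => /eqP.
have B0 : 0 <= M * rnorm y + rnorm u by rewrite addr_ge0 ?mulr_ge0 ?rnorm_ge0.
apply: rnorm0_eq0; apply: (eq0_small _ B0); rewrite ?rnorm_ge0// => e e0.
have /cvg_rnormP/(_ _ e0)[N /(_ N (leqnn _))] := @basis_cvg x.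
set S := comb _ _ _ => Se.
have -> : dot (A x) y - dot x u = dot (A (x - S)) y - dot (x - S) u.
  rewrite (blB AM) !linearBl/= opprB.
  suff -> : dot (A S) y = dot S u by rewrite addrA subrK.
  rewrite bl_comb dot_combl.
  have -> : dot (\sum_(0 <= i < N) dot x (f i) *: A (f i)) y =
            \sum_(0 <= i < N) dot x (f i) * dot (A (f i)) y.
    elim/big_ind2: _ => [|z a z' a' <- <-|i _].
    - by rewrite linear0l.
    - by rewrite linearDl.
    - by rewrite linearZl_LR.
  by apply: eq_bigr => i _; rewrite (dot_sym _ (f i)) uc -dot_sym.
rewrite (le_trans (ler_rnormD _ _))// rnormN mulrDl lerD//.
  rewrite (le_trans (dot_CauchySchwarz dot_norm _ _))// mulrAC ler_wpM2r ?rnorm_ge0//.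
  by rewrite (le_trans (bl_bound AM _))// ler_wpM2l// rdistC.
rewrite (le_trans (dot_CauchySchwarz dot_norm _ _))// mulrC ler_wpM2l ?rnorm_ge0//.
by rewrite rdistC.
Qed.

Lemma adjointE x y : dot (A x) y = dot x (adjoint dot A y).
Proof. exact: (xgetPex _ (adjoint_exists y)). Qed.

Lemma dot_ext x y : (forall z, dot z x = dot z y) -> x = y.
Proof.
by move=> xy; apply: basis_ext => n; rewrite dot_sym xy -dot_sym.
Qed.

(** The bound comes from [dot u u = dot (A u) y] for [u := adjoint dot A y]. *)
Lemma adjoint_bounded : bounded_linear (adjoint dot A) M.
Proof.
split=> [|c x y|y]; first exact: bl_ge0 AM.
  by apply: dot_ext => z; rewrite -adjointE !linearPr/= -!adjointE.
have [->|] := eqVneq (rnorm (adjoint dot A y)) 0.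
  by rewrite mulr_ge0 ?rnorm_ge0 ?(bl_ge0 AM).
set r := rnorm _ => r0; have rp : 0 < r by rewrite lt_def r0 rnorm_ge0.
have := dot_CauchySchwarz dot_norm (A (adjoint dot A y)) y.
rewrite adjointE (dot_rnorm dot_norm) rnorm_real ?sqr_ge0// -/r => ry.
have := ler_wpM2r (rnorm_ge0 y) (bl_bound AM (adjoint dot A y)).
move=> /(le_trans ry); rewrite -/r expr2 mulrAC ler_pM2r//.
Qed.

Lemma iter_adjointE n x y : dot (iter n A x) y = dot x (iter n (adjoint dot A) y).
Proof. by elim: n x y => //= n IH x y; rewrite adjointE IH -iterSr. Qed.

End Adjoint.
End OrthonormalBasis.

(** * Unconditionally convergent double series *)

Section DoubleSeries.
Context {R : realType}.
Implicit Types (F : {fset nat * nat}) (c : nat * nat -> R[i]).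

Definition square N : seq (nat * nat) :=
  [seq (m, n) | m <- iota 0 N, n <- iota 0 N].

Lemma mem_square N p : (p \in square N) = (p.1 < N)%N && (p.2 < N)%N.
Proof.
case: p => m n; apply/allpairsP/idP => /=.
  by case=> -[i j] /=; rewrite !mem_iota /= => -[iN jN [-> ->]]; rewrite iN jN.
by case/andP=> mN nN; exists (m, n); rewrite /= !mem_iota.
Qed.

Lemma square_uniq N : uniq (square N).
Proof. by apply: allpairs_uniq; rewrite ?iota_uniq// => -[? ?] [? ?]. Qed.

Lemma sum_square (V : nmodType) N (g : nat * nat -> V) :
  \sum_(p <- square N) g p = \sum_(m < N) \sum_(n < N) g (m : nat, n : nat).
Proof.
rewrite big_allpairs_dep/= -(big_mkord xpredT (fun m => \sum_(n < N) g (m, n : nat))).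
rewrite /index_iota subn0; apply: eq_bigr => m _.
by rewrite -(big_mkord xpredT (fun n => g (m, n))) /index_iota subn0.
Qed.

Lemma ler_sum_subseq (s t : seq (nat * nat)) (g : nat * nat -> R) :
  uniq s -> uniq t -> {subset s <= t} -> (forall p, 0 <= g p) ->
  \sum_(p <- s) g p <= \sum_(p <- t) g p.
Proof.
move=> us ut st g0; rewrite [leRHS](bigID (mem s))/= -[X in _ <= X + _]big_filter.
have pe : perm_eq [seq p <- t | p \in s] s.
  apply: uniq_perm => //; first exact: filter_uniq.
  by move=> p; rewrite mem_filter; case: (boolP (p \in s)) => // /st.
by rewrite (perm_big _ pe)/= lerDl sumr_ge0.
Qed.

Lemma sum_half_le N : \sum_(m < N) (2^-1 : R) ^+ m <= 2.
Proof.
suff -> : \sum_(m < N) (2^-1 : R) ^+ m = 2 - 2 * 2^-1 ^+ N.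
  by rewrite gerBl mulr_ge0// exprn_ge0// invr_ge0.
by elim: N => [|N IH]; rewrite ?big_ord0 ?big_ord_recr/= ?IH ?exprS; field.
Qed.

Lemma sum_half2_le (s : seq (nat * nat)) : uniq s ->
  \sum_(p <- s) (2^-1 : R) ^+ p.1 * 2^-1 ^+ p.2 <= 4.
Proof.
move=> us; pose N := \max_(p <- s) (p.1 + p.2).+1.
have sN : {subset s <= square N}.
  move=> p ps; rewrite mem_square.
  have pN : ((p.1 + p.2).+1 <= N)%N by rewrite /N (big_rem p)//= leq_maxl.
  by rewrite !(leq_trans _ pN)// ltnS ?leq_addr ?leq_addl.
have h0 m : 0 <= (2^-1 : R) ^+ m by rewrite exprn_ge0// invr_ge0.
apply: le_trans (ler_sum_subseq us (square_uniq N) sN _) _.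
  by move=> p; rewrite mulr_ge0.
rewrite sum_square/=; under eq_bigr do rewrite -mulr_sumr.
rewrite -mulr_suml; have S2 := sum_half_le N.
have S0 : 0 <= \sum_(m < N) (2^-1 : R) ^+ m by rewrite sumr_ge0.
nra.
Qed.

Lemma partial_sumE (V : zmodType) (c : nat * nat -> V) F :
  partial_sum c F = \sum_(p <- F) c p.
Proof. by rewrite /partial_sum big_seq_fsetE. Qed.

(** The squares exhaust the index set, so that a series dominated by a double
    geometric one and summed along the squares is summed unconditionally. *)
Lemma unconditional_sum c (k : R[i]) (B : R) :
  (forall p, rnorm (c p) <= 4^-1 ^+ p.1 * 4^-1 ^+ p.2) -> 0 <= B ->
  (forall N, rnorm (k - \sum_(p <- square N) c p) <= B * 2^-1 ^+ N) ->
  forall e : R, 0 < e -> exists F0, forall F, (F0 `<=` F)%fset ->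
    rnorm (k - \sum_(p <- F) c p) <= e.
Proof.
move=> c4 B0 kB e e0.
have B4 : 0 < B + 4 by lra.
have [|N NP] := @expr_half_small R (e / (B + 4)); first by rewrite divr_gt0.
exists (seq_fset tt (square N)) => F /fsubsetP NF.
have sF : {subset square N <= F} by move=> p pN; apply: NF; rewrite seq_fsetE.
have h0 m : 0 <= (2^-1 : R) ^+ m by rewrite exprn_ge0// invr_ge0.
rewrite (bigID (mem (square N)))/= -big_filter.
have pe : perm_eq [seq p <- F | p \in square N] (square N).
  apply: uniq_perm; rewrite ?filter_uniq ?fset_uniq ?square_uniq//.
  by move=> p; rewrite mem_filter; case: (boolP (p \in _)) => // /sF.
rewrite (perm_big _ pe)/= opprD addrA (le_trans (ler_rnormD _ _))// rnormN.
have tail : rnorm (\sum_(p <- F | p \notin square N) c p) <= 4 * 2^-1 ^+ N.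
  rewrite (le_trans (ler_rnorm_sum _ _ _))//.
  apply: (@le_trans _ _ (\sum_(p <- F) 2^-1 ^+ N * (2^-1 ^+ p.1 * 2^-1 ^+ p.2))).
    rewrite [leRHS](bigID (mem (square N)))/= -[leLHS]add0r lerD//.
      by apply: sumr_ge0 => p _; rewrite !mulr_ge0.
    apply: ler_sum => p pN; rewrite (le_trans (c4 p))//.
    have -> : (4^-1 : R) = 2^-1 * 2^-1 by rewrite -invfM -natrM.
    rewrite !exprMn mulrACA ler_wpM2r ?mulr_ge0// -exprD.
    rewrite ler_wiXn2l ?invr_ge0// ?invf_le1 ?ler1n//.
    move: pN; rewrite mem_square negb_and -!leqNgt => /orP[] /leq_trans -> //.
      exact: leq_addr.
    exact: leq_addl.
  by rewrite -mulr_sumr mulrC ler_wpM2r// sum_half2_le// fset_uniq.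
rewrite (le_trans (lerD (kB N) tail))// -mulrDl mulrC -ler_pdivlMr//.
Qed.

(** Let [(m, n)] be the index of a nonzero coefficient, with [n] least and then [m]
    least.  On the curve [z = t], [w = t ^+ m.+1] its monomial is of strictly lower
    order in [t] than those of all the other nonzero coefficients. *)
Lemma double_series_unique (D : nat * nat -> R[i]) (d : R) : 0 < d ->
  (forall z w : R, 0 < z < d -> 0 < w < d -> forall e : R, 0 < e ->
    exists F0, forall F, (F0 `<=` F)%fset ->
      rnorm (\sum_(p <- F) real_complex R (z ^+ p.1 * w ^+ p.2) * D p) <= e) ->
  forall p, D p = 0.
Proof.
move=> d0 sumD; pose r := d / 2.
have r0 : 0 < r by rewrite divr_gt0.
have rd : 0 < r < d by rewrite r0/= /r; lra.
(* The terms of an unconditionally convergent series are bounded. *)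
have [M M0 DM] :
    exists2 M, 0 <= M & forall p, rnorm (D p) * (r ^+ p.1 * r ^+ p.2) <= M.
  have [F0 F0P] := sumD r r rd rd 1 ltr01.
  pose g p := rnorm (D p) * (r ^+ p.1 * r ^+ p.2).
  have g0 p : 0 <= g p by rewrite /g !mulr_ge0 ?exprn_ge0 ?rnorm_ge0// ltW.
  have S0 : 0 <= \sum_(p <- F0) g p by rewrite sumr_ge0.
  exists (2 + \sum_(p <- F0) g p) => [|p]; first by rewrite addr_ge0.
  have [pF|pF] := boolP (p \in F0).
    rewrite (big_rem p)//= -/(g p) addrA addrAC lerDr addr_ge0// sumr_ge0//.
  have := F0P _ (fsubsetU1 p F0); have := F0P _ (fsubset_refl F0).
  rewrite big_fsetU1//=; set S := \sum_(_ <- F0) _; set T := (X in rnorm (X + _)).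
  have -> : rnorm (D p) * (r ^+ p.1 * r ^+ p.2) = rnorm T.
    by rewrite /T rnormM rnorm_real 1?mulrC// mulr_ge0 ?exprn_ge0// ltW.
  have := ler_rnormD (T + S) (- S); rewrite addrK rnormN; lra.
suff {}D0 n m : (forall q, (q.2 < n)%N -> D q = 0) ->
    (forall i, (i < m)%N -> D (i, n) = 0) -> D (m, n) = 0.
  have D2 n : forall q, (q.2 < n)%N -> D q = 0.
    elim: n => // n IH [i j]; rewrite /= ltnS leq_eqVlt.
    move=> /orP[/eqP ->|jn]; last exact: IH.
    elim/ltn_ind: i => i IHi; exact: D0.
  by move=> q; exact: (D2 q.2.+1).
move=> Dn Dm; pose P := m.+1; pose K := (m + P * n)%N.
(* The curve is [z = s * ta], [w = z ^+ P] for [s] in ]0, 1], where [ta] is so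
   small that [ta / r <= 1 / 2], which makes the sum of the norms of all the other
   terms at most [4 * M * s ^+ K.+1]. *)
pose ta := Num.min r 1 / 2.
have min0 : 0 < Num.min r 1 by rewrite lt_min r0 ltr01.
have ta0 : 0 < ta by rewrite divr_gt0.
have tar : ta <= r * 2^-1 by rewrite ler_pM2r ?invr_gt0// ge_min lexx.
have ta1 : ta <= 1.
  by rewrite ler_pdivrMr// mul1r (@le_trans _ _ 1) ?ge_min ?lexx ?orbT ?ler1n.
suff taD : ta ^+ K * rnorm (D (m, n)) = 0.
  move/eqP: taD; rewrite mulf_eq0 expf_eq0 (gt_eqF ta0) andbF/= => /eqP.
  exact: rnorm0_eq0.
have key s : 0 < s <= 1 -> ta ^+ K * rnorm (D (m, n)) <= 4 * M * s.
  move=> /andP[s0 s1]; pose z := s * ta; pose w := z ^+ P.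
  have z0 : 0 < z by rewrite mulr_gt0.
  have z1 : z <= 1 by rewrite mulr_ile1// ltW.
  have zr : z <= r * 2^-1 by rewrite (le_trans _ tar)// ler_piMl// ltW.
  have zd : 0 < z < d by rewrite z0 (le_lt_trans zr)// /r; lra.
  have w0 : 0 < w by rewrite exprn_gt0.
  have wd : 0 < w < d.
    rewrite w0; case/andP: zd => _; apply: le_lt_trans.
    by rewrite /w /P exprS ler_piMr ?(ltW z0)// exprn_ile1 ?(ltW z0).
  have zw q : z ^+ q.1 * w ^+ q.2 = z ^+ (q.1 + P * q.2) by rewrite /w -exprM exprD.
  have small q : q != (m, n) ->
      rnorm (real_complex R (z ^+ q.1 * w ^+ q.2) * D q) <=
      s ^+ K.+1 * M * (2^-1 ^+ q.1 * 2^-1 ^+ q.2).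
    move=> qmn; have zq0 : 0 <= z ^+ q.1 * w ^+ q.2.
      by rewrite mulr_ge0 ?exprn_ge0 ?ltW.
    have h0 i : 0 <= (2^-1 : R) ^+ i by rewrite exprn_ge0// invr_ge0.
    have s0' i : 0 <= s ^+ i by rewrite exprn_ge0// ltW.
    have [->|Dq0] := eqVneq (D q) 0.
      by rewrite mulr0 rnorm0 !mulr_ge0.
    have qK : (K < q.1 + P * q.2)%N.
      rewrite ltnNge; apply: contra Dq0 => qK; apply/eqP.
      have [qn|nq] := ltnP q.2 n; first exact: Dn.
      case: q qK qmn nq {zq0} => i j /= qK qmn nj.
      have ji : j = n.
        apply/eqP; rewrite eqn_leq nj andbT leqNgt; apply/negP => nj'.
        move: qK; rewrite leqNgt => /negP; apply.
        rewrite (@leq_trans (P * n.+1)) ?(leq_trans (leq_mul (leqnn P) nj')) ?leq_addl//.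
        by rewrite mulnS /K addnC -addnS addnC.
      rewrite ji; apply: Dm; rewrite ltn_neqAle.
      have im : (i <= m)%N by move: qK; rewrite ji /K leq_add2r.
      by rewrite im andbT; apply: contra qmn => /eqP ->; rewrite ji.
    rewrite rnormM rnorm_real// zw /z exprMn -!mulrA.
    apply: ler_pM => //; rewrite ?mulr_ge0 ?exprn_ge0 ?rnorm_ge0 ?(ltW ta0)//.
      by rewrite ler_wiXn2l// ltW.
    apply: (@le_trans _ _ ((r * 2^-1) ^+ q.1 * (r * 2^-1) ^+ q.2 * rnorm (D q))).
      rewrite ler_wpM2r ?rnorm_ge0// exprD ler_pM ?exprn_ge0 ?(ltW ta0)//.
        by rewrite lerXn2r// nnegrE ltW// mulr_gt0 ?invr_gt0.
      rewrite (@le_trans _ _ (ta ^+ q.2))//.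
        by rewrite ler_wiXn2l ?(ltW ta0)// leq_pmull.
      by rewrite lerXn2r// nnegrE ltW// mulr_gt0 ?invr_gt0.
    rewrite (exprMn q.1 r) (exprMn q.2 r) mulrACA [leLHS]mulrAC.
    by rewrite ler_wpM2r ?mulr_ge0// mulrC; exact: DM.
  have z0' : 0 <= z ^+ K by rewrite exprn_ge0// ltW.
  have zD : z ^+ K * rnorm (D (m, n)) <= 4 * M * s ^+ K.+1.
    apply/ler_addgt0Pr => e e0; have [F0 F0P] := sumD z w zd wd e e0.
    have := F0P _ (fsubsetU1 (m, n) F0).
    rewrite (big_fsetD1 (m, n)) ?fset1U1//=; set T := (X in rnorm (X + _)).
    set S := \sum_(_ <- _) _ => TS.
    have TE : rnorm T = z ^+ K * rnorm (D (m, n)).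
      by rewrite /T rnormM rnorm_real -?(zw (m, n))// mulr_ge0// exprn_ge0// ltW.
    have SM : rnorm S <= 4 * M * s ^+ K.+1.
      rewrite (le_trans (ler_rnorm_sum _ _ _))//.
      apply: (@le_trans _ _ (\sum_(q <- (((m, n) |` F0) `\ (m, n))%fset)
                s ^+ K.+1 * M * (2^-1 ^+ q.1 * 2^-1 ^+ q.2))).
        rewrite big_seq [leRHS]big_seq; apply: ler_sum => q.
        by rewrite !inE => /andP[/small].
      rewrite -mulr_sumr -[leRHS]mulrA [leRHS]mulrC [M * _]mulrC.
      rewrite ler_wpM2l ?sum_half2_le ?fset_uniq//.
      by rewrite mulr_ge0// exprn_ge0// ltW.
    have := ler_rnormD (T + S) (- S); rewrite addrK rnormN TE; lra.
  have sK : 0 < s ^+ K by rewrite exprn_gt0.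
  rewrite -(ler_pM2l sK); move: zD.
  have -> : z ^+ K = s ^+ K * ta ^+ K by rewrite exprMn.
  by rewrite exprSr -mulrA [X in _ <= X](_ : _ = s ^+ K * (4 * M * s))//; ring.
apply: (@eq0_small _ _ (4 * M)); rewrite ?mulr_ge0 ?exprn_ge0 ?rnorm_ge0 ?(ltW ta0)//.
move=> e e0; have := key (Num.min e 1).
rewrite lt_min e0 ltr01 ge_min lexx orbT => /(_ isT) se.
rewrite (le_trans se)// ler_wpM2l ?mulr_ge0// ge_min lexx//.
Qed.

End DoubleSeries.

(** * Square-summable solutions of a linear recursion *)

Section Recursion.
Context {R : realType}.
Implicit Types (s y v : nat -> R).

(** Convexity of the square gives
    [(1 - rho) * (v + rho * y) ^+ 2 <= v ^+ 2 + (1 - rho) * rho * y ^+ 2]; the last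
    term, summed over [n], is absorbed in the left-hand side. *)
Lemma recursion_bound_contractive s (rho : R) : 0 <= rho < 1 ->
  (forall n, s n <= rho) ->
  forall y v, (forall n, 0 <= y n) -> (forall n, 0 <= v n) ->
    y 0%N <= v 0%N -> (forall n, y n.+1 <= v n.+1 + s n * y n) ->
  forall N, (1 - rho) ^+ 2 * \sum_(0 <= n < N) y n ^+ 2 <= \sum_(0 <= n < N) v n ^+ 2.
Proof.
move=> /andP[rho0 rho1] sr y v y0 v0 yv0 yv [|N]; first by rewrite !big_geq// mulr0.
set t := 1 - rho; have t0 : 0 < t by rewrite /t; lra.
have step n : t * y n.+1 ^+ 2 <= v n.+1 ^+ 2 + t * rho * y n ^+ 2.
  have le1 : y n.+1 <= v n.+1 + rho * y n.
    by rewrite (le_trans (yv n))// lerD2l ler_wpM2r.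
  have le2 : y n.+1 ^+ 2 <= (v n.+1 + rho * y n) ^+ 2.
    by rewrite lerXn2r// nnegrE ?addr_ge0 ?mulr_ge0.
  apply: le_trans (ler_wpM2l (ltW t0) le2) _.
  rewrite -subr_ge0 [leRHS](_ : _ = rho * (v n.+1 - t * y n) ^+ 2).
    by rewrite mulr_ge0// sqr_ge0.
  by rewrite /t; ring.
have H : t * \sum_(0 <= n < N.+1) y n ^+ 2 <=
    \sum_(0 <= n < N.+1) v n ^+ 2 + t * rho * \sum_(0 <= n < N) y n ^+ 2.
  elim: N => [|N IH].
    rewrite !big_nat1 big_geq// mulr0 addr0.
    have : y 0%N ^+ 2 <= v 0%N ^+ 2 by rewrite lerXn2r// nnegrE.
    apply: le_trans; rewrite ler_piMl ?sqr_ge0//; rewrite /t; lra.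
  rewrite big_nat_recr//= [X in _ <= X + _]big_nat_recr//=.
  rewrite [X in _ <= _ + _ * X]big_nat_recr//=.
  by have := step N; lra.
have : t * rho * \sum_(0 <= n < N) y n ^+ 2 <= t * rho * \sum_(0 <= n < N.+1) y n ^+ 2.
  rewrite ler_wpM2l ?mulr_ge0 ?(ltW t0)// [leRHS]big_nat_recr//= lerDl sqr_ge0//.
move: H; set Y := \sum_(0 <= n < N.+1) y n ^+ 2.
set Z := \sum_(0 <= n < N) _; set V := \sum_(0 <= n < N.+1) _.
move=> h1 h2; have -> : t ^+ 2 * Y = t * Y - t * rho * Y by rewrite /t; ring.
lra.
Qed.

(** Only finitely many of the factors [s n] exceed [rho]: they are removed one
    at a time, by shifting the sequences. *)
Lemma recursion_bound (N0 : nat) s (rho : R) : 0 <= rho < 1 ->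
  (forall n, 0 <= s n) -> (forall n, (N0 <= n)%N -> s n <= rho) ->
  exists2 C : R, 0 <= C &
  forall y v, (forall n, 0 <= y n) -> (forall n, 0 <= v n) ->
    y 0%N <= v 0%N -> (forall n, y n.+1 <= v n.+1 + s n * y n) ->
  forall N, \sum_(0 <= n < N) y n ^+ 2 <= C * \sum_(0 <= n < N) v n ^+ 2.
Proof.
move=> rho01; elim: N0 s => [|N0 IH] s s0 sr.
  have t0 : 0 < (1 - rho) ^+ 2 by rewrite exprn_gt0//; case/andP: rho01; lra.
  exists ((1 - rho) ^+ 2)^-1 => [|y v y0 v0 yv0 yv N]; first by rewrite invr_ge0 ltW.
  rewrite mulrC ler_pdivlMr// mulrC.
  by rewrite (recursion_bound_contractive rho01 (fun n => sr n isT)).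
have [|n nN|C C0 CP] := IH (fun n => s n.+1); [by move=> n|exact: sr|].
exists (1 + C * (2 + 2 * s 0%N ^+ 2)) => [|y v y0 v0 yv0 yv [|N]].
- by rewrite addr_ge0// mulr_ge0// addr_ge0// mulr_ge0// sqr_ge0.
- by rewrite !big_geq// mulr0.
have v'0 n : 0 <= (if n is 0%N then v 1%N + s 0%N * y 0%N else v n.+1).
  by case: n => //; rewrite addr_ge0// mulr_ge0.
have := CP (fun n => y n.+1) (fun n => if n is 0%N then v 1%N + s 0%N * y 0%N else v n.+1)
  (fun n => y0 _) v'0 (yv 0%N) (fun n => yv n.+1) N.
rewrite big_nat_recl//= => le1.
have sq0 : y 0%N ^+ 2 <= v 0%N ^+ 2 by rewrite lerXn2r// nnegrE.
set V := \sum_(0 <= n < N.+1) v n ^+ 2.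
have V0 : v 0%N ^+ 2 <= V.
  by rewrite /V big_nat_recl// lerDl sumr_ge0// => i _; exact: sqr_ge0.
have le2 : \sum_(0 <= n < N) (if n is 0%N then v 1%N + s 0%N * y 0%N else v n.+1) ^+ 2
    <= (2 + 2 * s 0%N ^+ 2) * V.
  case: N @V V0 {le1} => [|N] V V0.
    rewrite big_geq// mulr_ge0//; first by rewrite addr_ge0// mulr_ge0// sqr_ge0.
    exact: le_trans (sqr_ge0 _) V0.
  rewrite big_nat_recl//= /V big_nat_recl// big_nat_recl//=.
  set W := \sum_(0 <= n < N) _.
  have W0 : 0 <= W by rewrite /W sumr_ge0// => i _; exact: sqr_ge0.
  have : (v 1%N + s 0%N * y 0%N) ^+ 2 <= 2 * v 1%N ^+ 2 + 2 * s 0%N ^+ 2 * y 0%N ^+ 2.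
    by rewrite -subr_ge0 [leRHS](_ : _ = (v 1%N - s 0%N * y 0%N) ^+ 2) ?sqr_ge0//; ring.
  have : 2 * s 0%N ^+ 2 * y 0%N ^+ 2 <= 2 * s 0%N ^+ 2 * v 0%N ^+ 2.
    by rewrite ler_wpM2l// mulr_ge0// sqr_ge0.
  have : 0 <= 2 * s 0%N ^+ 2 * (v 1%N ^+ 2 + W).
    by rewrite mulr_ge0 ?addr_ge0 ?mulr_ge0 ?sqr_ge0.
  have := sqr_ge0 (v 0%N); lra.
have := ler_wpM2l C0 le2; move: le1; lra.
Qed.

End Recursion.

(** * Taylor coefficients in a tridiagonal space *)

Section TridiagonalSpace.
Context {R : realType} {H : completeNormedModType R[i]}.
Variables (dot : {dot H for Num.conj}) (ev : H -> R[i] -> R[i]).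
Variables (k : R[i] -> R[i] -> R[i]) (a b : nat -> R[i]) (f : nat -> H).
Hypothesis ats : analytic_tridiagonal_space dot ev k a b f.

Let sat := ats.1.
Let dot_norm := rkhs_norm (sat_rkhs sat).
Let f_basis := sat_basis sat.
Let a_neq0 := sat_a_neq0 sat.

Let s n := rnorm (b n / a n.+1).

Lemma tail_ratio : exists N0 rho, 0 <= rho < 1 /\ forall n, (N0 <= n)%N -> s n <= rho.
Proof.
have /ereal_inf_lt[_ [W [N _ NW] <-] supW] := sat_limsup sat.
have sW n : (N <= n)%N ->
    ((s n)%:E <= ereal_sup [set (Normc.normc (b n / a n.+1))%:E | n in W])%E.
  by move=> Nn; apply: ereal_sup_ubound; exists n => //; exact: NW.
move: supW sW; case: (ereal_sup _) => [r|//|] r1 sW.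
  exists N, r; split; last by move=> n /sW; rewrite lee_fin.
  by rewrite -lte_fin r1 andbT -lee_fin (le_trans _ (sW N (leqnn N)))// lee_fin rnorm_ge0.
by have := sW N (leqnn N).
Qed.

Lemma ratio_bound : exists2 sigma : R, 0 <= sigma & forall n, s n <= sigma.
Proof.
have [N0 [rho [/andP[rho0 _] srho]]] := tail_ratio.
have S0 : 0 <= \sum_(0 <= i < N0) s i by rewrite sumr_ge0// => i _; exact: rnorm_ge0.
exists (rho + \sum_(0 <= i < N0) s i) => [|n]; first exact: addr_ge0.
have [/srho sn|nN] := leqP N0 n; first by rewrite (le_trans sn)// lerDl.
rewrite -[leLHS]add0r lerD// (bigD1_seq n) ?mem_index_iota ?iota_uniq//= lerDl.
by rewrite sumr_ge0// => i _; exact: rnorm_ge0.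
Qed.

(** The [n]-th Taylor coefficient at the origin of the function [ev x]. *)
Definition taylor (x : H) (n : nat) : R[i] :=
  a n * dot x (f n) + (if n is m.+1 then b m * dot x (f m) else 0).

Lemma taylor_linear c x y n : taylor (c *: x + y) n = c * taylor x n + taylor y n.
Proof.
rewrite /taylor linearPl/= mulrDr mulrCA mulrDr -!addrA; congr (_ + _).
case: n => [|n]; first by rewrite mulr0 add0r.
by rewrite linearPl/= mulrDr (mulrCA (b n)) addrCA.
Qed.

Lemma taylorZ c x n : taylor (c *: x) n = c * taylor x n.
Proof.
have := taylor_linear c x 0 n; rewrite addr0 => ->.
have -> : taylor 0 n = 0; last by rewrite addr0.
by rewrite /taylor linear0l mulr0 add0r; case: n => // n; rewrite linear0l mulr0.
Qed.

Lemma taylorB x y n : taylor (x - y) n = taylor x n - taylor y n.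
Proof. by rewrite addrC -scaleN1r taylor_linear mulN1r addrC. Qed.

Lemma taylor_basis n m :
  taylor (f n) m = if m == n then a n else if m == n.+1 then b n else 0.
Proof.
rewrite /taylor; case: m => [|m]; rewrite !(dot_basis f_basis).
  by rewrite addr0 eq_sym; case: eqP => [<-|]; rewrite ?mulr1 ?mulr0.
rewrite eqSS (eq_sym n) (eq_sym n m); have [<-|nm] := eqVneq m.+1 n.
  by rewrite mulr1 ltn_eqF// mulr0 addr0.
by rewrite mulr0 add0r; case: eqP => [->|]; rewrite ?mulr1 ?mulr0.
Qed.

(** As [a n] is nonzero, the coordinates are determined one after the other. *)
Lemma taylor_inj x y : (forall n, taylor x n = taylor y n) -> x = y.
Proof.
move=> xy; apply: (basis_ext f_basis) => n; apply: (mulfI (a_neq0 n)).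
elim: n => [|n IH]; first by have := xy 0%N; rewrite /taylor !addr0.
have := xy n.+1; rewrite /taylor.
by rewrite (mulfI (a_neq0 n) IH) => /addIr.
Qed.

Lemma taylor_bound : exists2 C : R, 0 <= C &
  forall x N, \sum_(0 <= n < N) rnorm (taylor x n / a n) ^+ 2 <= C * rnorm x ^+ 2.
Proof.
have [sigma sigma0 ssigma] := ratio_bound.
have C0 : 0 <= 2 + 2 * sigma ^+ 2 by rewrite addr_ge0// mulr_ge0// sqr_ge0.
exists (2 + 2 * sigma ^+ 2) => // x [|N].
  by rewrite big_geq// mulr_ge0// sqr_ge0.
pose u n := rnorm (dot x (f n)).
have [U1 U2] := (Bessel dot_norm f_basis x N.+1, Bessel dot_norm f_basis x N).
have : \sum_(0 <= n < N.+1) rnorm (taylor x n / a n) ^+ 2 <=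
    2 * \sum_(0 <= n < N.+1) u n ^+ 2 + 2 * sigma ^+ 2 * \sum_(0 <= n < N) u n ^+ 2.
  elim: N {U1 U2} => [|N IH].
    rewrite !big_nat1 big_geq// mulr0 addr0 /taylor addr0 mulrC mulKf//.
    by rewrite -/(u 0%N); have := sqr_ge0 (u 0%N); lra.
  rewrite big_nat_recr//= [X in _ <= 2 * X + _]big_nat_recr//=.
  rewrite [X in _ <= _ + _ * X]big_nat_recr//=.
  suff : rnorm (taylor x N.+1 / a N.+1) ^+ 2 <=
    2 * u N.+1 ^+ 2 + 2 * sigma ^+ 2 * u N ^+ 2 by lra.
  have -> : taylor x N.+1 / a N.+1 = dot x (f N.+1) + b N / a N.+1 * dot x (f N).
    by rewrite /taylor; field.
  have h : rnorm (dot x (f N.+1) + b N / a N.+1 * dot x (f N)) <= u N.+1 + sigma * u N.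
    rewrite (le_trans (ler_rnormD _ _))// lerD2l rnormM.
    by rewrite ler_wpM2r ?rnorm_ge0//; exact: ssigma.
  apply: (@le_trans _ _ ((u N.+1 + sigma * u N) ^+ 2)).
    by rewrite lerXn2r// nnegrE ?rnorm_ge0// (le_trans (rnorm_ge0 _) h).
  rewrite -subr_ge0.
  by rewrite [leRHS](_ : _ = (u N.+1 - sigma * u N) ^+ 2) ?sqr_ge0//; ring.
move=> h; apply: le_trans h _; rewrite [leRHS]mulrDl; apply: lerD.
  exact: ler_wpM2l.
by rewrite ler_wpM2l// mulr_ge0// sqr_ge0.
Qed.

Fixpoint coordinates (t : nat -> R[i]) (n : nat) : R[i] :=
  if n is m.+1 then (t m.+1 - b m * coordinates t m) / a m.+1 else t 0%N / a 0%N.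

(** With [taylor_bound], this identifies the space, up to equivalence of norms, with
    the weighted l2 space of the power series [t] for which the sum of the
    [rnorm (t n / a n) ^+ 2] is finite.  The norms of the coordinates satisfy the
    recursive inequality of [recursion_bound]. *)
Lemma taylor_synthesis : exists2 C : R, 0 <= C &
  forall t (V : R), (forall N, \sum_(0 <= n < N) rnorm (t n / a n) ^+ 2 <= V) ->
  exists x, (forall n, taylor x n = t n) /\ rnorm x ^+ 2 <= C * V.
Proof.
have [N0 [rho [rho01 srho]]] := tail_ratio.
have [C C0 CP] := recursion_bound rho01 (fun n => rnorm_ge0 _) srho.
exists C => // t V tV.
have V0 : 0 <= V by have := tV 0%N; rewrite big_geq.
have cV N : \sum_(0 <= n < N) rnorm (coordinates t n) ^+ 2 <= C * V.
  apply: le_trans (ler_wpM2l C0 (tV N)).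
  apply: (CP (fun n => rnorm (coordinates t n)) (fun n => rnorm (t n / a n))) => //.
  - by move=> n; exact: rnorm_ge0.
  - by move=> n; exact: rnorm_ge0.
  - move=> n /=; rewrite mulrBl -(rnormM (b n / a n.+1)) mulrAC.
    by rewrite (le_trans (ler_rnormD _ _))// rnormN.
have [x xc] := Riesz_Fischer dot_norm f_basis cV.
exists x; split.
  case=> [|n]; rewrite /taylor !xc/=; first by rewrite addr0 mulrC divfK.
  by rewrite mulrC divfK// subrK.
apply: (Parseval_le dot_norm f_basis) => [|N]; first by rewrite mulr_ge0.
by under eq_bigr do rewrite xc.
Qed.

Lemma operator_of_taylor (Phi : H -> nat -> R[i]) (C : R) : 0 <= C ->
  (forall c x y n, Phi (c *: x + y) n = c * Phi x n + Phi y n) ->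
  (forall x N, \sum_(0 <= n < N) rnorm (Phi x n / a n) ^+ 2 <= C * rnorm x ^+ 2) ->
  exists A, (exists M, bounded_linear A M) /\ forall x n, taylor (A x) n = Phi x n.
Proof.
move=> C0 Phi_lin PhiC; have [C' C'0 synth] := taylor_synthesis.
have [A AP] := choice (fun x => synth _ _ (PhiC x)).
exists A; split; last by move=> x; exact: (AP x).1.
have M0 := mulr_ge0 C'0 C0.
exists (Num.sqrt (C' * C)); split => [|c x y|x]; first exact: sqrtr_ge0.
  apply: taylor_inj => n.
  by rewrite taylor_linear !(AP _).1 Phi_lin.
rewrite -(@ler_sqr R) ?nnegrE ?mulr_ge0 ?rnorm_ge0 ?sqrtr_ge0//.
by rewrite exprMn sqr_sqrtr// -mulrA (AP x).2.
Qed.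

End TridiagonalSpace.

(** * The shift and its Shimorin inverse *)

Section Shift.
Context {R : realType} {H : completeNormedModType R[i]}.
Variables (dot : {dot H for Num.conj}) (ev : H -> R[i] -> R[i]).
Variables (k : R[i] -> R[i] -> R[i]) (a b : nat -> R[i]) (f : nat -> H).
Hypothesis ats : analytic_tridiagonal_space dot ev k a b f.

Let sat := ats.1.
Let dot_norm := rkhs_norm (sat_rkhs sat).
Let f_basis := sat_basis sat.
Let a_neq0 := sat_a_neq0 sat.

Local Notation taylor := (taylor dot a b f).

Lemma unit_discN (w : R[i]) : unit_disc w -> unit_disc (- w).
Proof. by rewrite /unit_disc/= normrN. Qed.

(** The values of [f n] at [w] and at [- w] are bounded in [n], being inner
    products with two fixed elements; together they separate the two monomials of
    [f n]. *)
Lemma basis_tail_bounded w : unit_disc w ->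
  exists2 B : R, 0 <= B & forall n, rnorm (b n * w ^+ n.+1) <= B.
Proof.
move=> wD; have [kw [_ kwP]] := rkhs_reproducing (sat_rkhs sat) wD.
have [kv [_ kvP]] := rkhs_reproducing (sat_rkhs sat) (unit_discN wD).
exists (rnorm kw + rnorm kv) => [|n]; first by rewrite addr_ge0 ?rnorm_ge0.
have fw g : rnorm (dot (f n) g) <= rnorm g.
  have := dot_CauchySchwarz dot_norm (f n) g.
  by rewrite (rnorm_basis dot_norm f_basis) mul1r.
have E : 2 * (b n * w ^+ n.+1) = dot (f n) kw - (-1) ^+ n * dot (f n) kv.
  rewrite kwP kvP !(sat_basis_ev sat)//; last exact: unit_discN.
  have ee : (-1) ^+ n * (-1) ^+ n = 1 :> R[i] by rewrite -expr2 sqrr_sign.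
  rewrite [(- w) ^+ n]exprNn exprS.
  transitivity ((a n + b n * w) * w ^+ n -
                (-1) ^+ n * (-1) ^+ n * ((a n - b n * w) * w ^+ n)).
    by rewrite ee; ring.
  by ring.
have : rnorm (2 * (b n * w ^+ n.+1)) <= rnorm kw + rnorm kv.
  rewrite E (le_trans (ler_rnormD _ _))// lerD// rnormN rnormM rnormX rnormN rnorm1.
  by rewrite expr1n mul1r.
rewrite rnormM rnorm_nat; have := rnorm_ge0 (b n * w ^+ n.+1); lra.
Qed.

Lemma coordinate_small x (e : R) : 0 < e ->
  exists N, forall n, (N <= n)%N -> rnorm (dot x (f n)) <= e.
Proof.
move=> e0; have /cvg_rnormP/(_ _ e0)[N /(_ N (leqnn _)) NP] :=
  @basis_cvg _ _ _ _ f_basis x.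
exists N => n Nn; rewrite -[x in dot x _](subrK (comb f (fun i => dot x (f i)) 0 N)).
rewrite linearDl/= (dot_comb_basis f_basis) ltnNge Nn/= addr0.
rewrite (le_trans (dot_CauchySchwarz dot_norm _ _))//.
rewrite (rnorm_basis dot_norm f_basis) mulr1.
by rewrite rdistC.
Qed.

(** The partial sums of the Taylor series differ from those of the expansion on
    the basis by one boundary term, which tends to [0] as a coordinate times a
    bounded factor. *)
Lemma taylor_series x w : unit_disc w -> forall e : R, 0 < e ->
  exists N, forall n, (N <= n)%N ->
    rnorm (ev x w - \sum_(0 <= i < n) taylor x i * w ^+ i) <= e.
Proof.
move=> wD e e0; have [B B0 BP] := basis_tail_bounded wD.
have [kw [_ kwP]] := rkhs_reproducing (sat_rkhs sat) wD.
have e20 : 0 < e / 2 by rewrite divr_gt0.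
have B1 : 0 < B + 1 by lra.
have [|N1 N1P] := @coordinate_small x (e / 2 / (B + 1)); first by rewrite divr_gt0.
have [N2 N2P] := cvg_dotl dot_norm kw (@basis_cvg _ _ _ _ f_basis x) e20.
exists (maxn N1 N2).+1 => -[//|n]; rewrite ltnS geq_max => /andP[/N1P n1 n2].
have {n2} := N2P _ (leqW n2); rewrite /= (kwP x) dot_combl.
have -> : \sum_(0 <= i < n.+1) dot x (f i) * dot (f i) kw =
  \sum_(0 <= i < n.+1) taylor x i * w ^+ i + dot x (f n) * (b n * w ^+ n.+1).
  elim: n {n1} => [|n IH].
    by rewrite !big_nat1 kwP (sat_basis_ev sat)// /taylor addr0; ring.
  rewrite big_nat_recr//= IH [in RHS]big_nat_recr//= kwP (sat_basis_ev sat)// /taylor.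
  by rewrite !exprS; ring.
rewrite rdistC opprD addrA => h.
rewrite -[X in rnorm X](subrK (dot x (f n) * (b n * w ^+ n.+1))).
rewrite (le_trans (ler_rnormD _ _))// [leRHS](_ : e = e / 2 + e / 2); last by field.
rewrite lerD// rnormM.
apply: (@le_trans _ _ (e / 2 / (B + 1) * (B + 1))); last by rewrite divfK// gt_eqF.
by rewrite ler_pM ?rnorm_ge0// (le_trans (BP n))// lerDl.
Qed.

Lemma ev_shifted_taylor x y :
  (forall n, taylor y n = if n is m.+1 then taylor x m else 0) ->
  forall w, unit_disc w -> ev y w = w * ev x w.
Proof.
move=> yx w wD; apply/eqP; rewrite -subr_eq0; apply/eqP; apply: rnorm0_eq0.
apply: (@eq0_small _ _ (1 + rnorm w)); rewrite ?rnorm_ge0 ?addr_ge0 ?rnorm_ge0//.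
move=> e e0; have [N1 N1P] := taylor_series y wD e0.
have [N2 N2P] := taylor_series x wD e0.
pose n := maxn N1 N2.
have := N1P n.+1 (leqW (leq_maxl _ _)); have := N2P n (leq_maxr _ _).
set S := \sum_(0 <= i < n) _; set S' := \sum_(0 <= i < n.+1) _ => h2 h1.
have SS : S' = w * S.
  rewrite /S' big_nat_recl//= yx mul0r add0r mulr_sumr; apply: eq_bigr => i _.
  by rewrite yx exprS mulrCA.
have -> : ev y w - w * ev x w = (ev y w - S') - w * (ev x w - S) by rewrite SS; ring.
rewrite (le_trans (ler_rnormD _ _))// mulrDl mul1r lerD// rnormN rnormM.
by rewrite ler_wpM2l// rnorm_ge0.
Qed.

Lemma forward_shift : exists T, (exists M, bounded_linear T M) /\
  forall x n, taylor (T x) n = if n is m.+1 then taylor x m else 0.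
Proof.
have [C C0 CP] := taylor_bound ats.
have [A AP] := sat_ratio_bounded sat.
have {}AP n : rnorm (a n / a n.+1) <= A by apply: AP; exists n.
have A0 : 0 <= A := le_trans (rnorm_ge0 _) (AP 0%N).
apply: (operator_of_taylor ats (C := A ^+ 2 * C)
  (Phi := fun x n => if n is m.+1 then taylor x m else 0)); first by rewrite mulr_ge0 ?sqr_ge0.
  by move=> c x y [|n] /=; [rewrite mulr0 addr0|rewrite taylor_linear].
move=> x [|N]; first by rewrite big_geq// mulr_ge0 ?sqr_ge0 ?mulr_ge0 ?sqr_ge0.
rewrite big_nat_recl// mul0r rnorm0 expr0n/= add0r.
apply: (@le_trans _ _ (A ^+ 2 * \sum_(0 <= n < N) rnorm (taylor x n / a n) ^+ 2)).
  rewrite mulr_sumr; apply: ler_sum => n _.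
  have -> : taylor x n / a n.+1 = a n / a n.+1 * (taylor x n / a n).
    by have [an0 an1] := (a_neq0 n, a_neq0 n.+1); field; rewrite an0 an1.
  by rewrite rnormM exprMn ler_wpM2r ?sqr_ge0// lerXn2r// nnegrE ?rnorm_ge0.
by rewrite -[leRHS]mulrA ler_wpM2l ?sqr_ge0.
Qed.

Lemma backward_shift : exists B, (exists M, bounded_linear B M) /\
  forall x n, taylor (B x) n = taylor x n.+1.
Proof.
have [C C0 CP] := taylor_bound ats.
have [e e0 eP] := ats.2.
apply: (operator_of_taylor ats (Phi := fun x n => taylor x n.+1) (C := e^-1 ^+ 2 * C)).
- by rewrite mulr_ge0 ?sqr_ge0.
- by move=> c x y n; rewrite taylor_linear.
move=> x N.
apply: (@le_trans _ _ (e^-1 ^+ 2 * \sum_(0 <= n < N.+1) rnorm (taylor x n / a n) ^+ 2)).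
  rewrite big_nat_recl// mulrDr mulr_sumr.
  apply: ler_wpDl; first by rewrite mulr_ge0 ?sqr_ge0.
  apply: ler_sum => n _.
  have -> : taylor x n.+1 / a n = (a n / a n.+1)^-1 * (taylor x n.+1 / a n.+1).
    by have [an0 an1] := (a_neq0 n, a_neq0 n.+1); field; rewrite an0 an1.
  rewrite (rnormM (_^-1)) exprMn ler_wpM2r ?sqr_ge0// lerXn2r// ?nnegrE ?rnorm_ge0 ?invr_ge0 ?(ltW e0)//.
  rewrite rnormV lef_pV2 ?posrE//; first exact: eP.
  exact: lt_le_trans e0 (eP n).
by rewrite -[leRHS]mulrA ler_wpM2l ?sqr_ge0.
Qed.

Local Notation T := (shift_op ev).

Lemma shift_op_spec : (exists M, bounded_linear T M) /\
  forall x n, taylor (T x) n = if n is m.+1 then taylor x m else 0.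
Proof.
have [S [Sb St]] := forward_shift.
suff -> : T = S by [].
apply/funext => x; have xS := ev_shifted_taylor (St x).
apply: (rkhs_ev_inj (sat_rkhs sat)) => w wD; rewrite xS//.
have := xgetPex (0 : H)
  (ex_intro [set h | forall w, unit_disc w -> ev h w = w * ev x w] (S x) xS).
exact.
Qed.

Let shift_bl := shift_op_spec.1.
Let taylor_shift := shift_op_spec.2.

Lemma dot_shift_f0 x : dot (T x) (f 0%N) = 0.
Proof.
have := taylor_shift x 0; rewrite /taylor addr0 => /eqP.
by rewrite mulf_eq0 (negPf (a_neq0 _)) => /eqP.
Qed.

Lemma adjoint_shiftE x y : dot (T x) y = dot x (adjoint dot T y).
Proof. by have [M TM] := shift_bl; exact: (adjointE dot_norm f_basis TM). Qed.

Lemma shift_of_orth_f0 y : dot y (f 0%N) = 0 -> exists x, T x = y.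
Proof.
move=> y0; have [B [_ BP]] := backward_shift.
exists (B y); apply: (taylor_inj ats) => -[|n]; rewrite taylor_shift//.
by rewrite /taylor y0 mulr0 addr0.
Qed.

(** The range of the shift contains all the [f n.+1] and is orthogonal to [f 0]. *)
Lemma shimorin_spaceP y : shimorin_space dot T y <-> y = dot y (f 0%N) *: f 0%N.
Proof.
split=> [yW|->].
  apply: (basis_ext f_basis) => -[|n]; rewrite linearZl_LR/= (dot_basis f_basis) ?mulr1//.
  rewrite mulr0; have [|x xf] := @shift_of_orth_f0 (f n.+1); first by rewrite (dot_basis f_basis).
  by rewrite dot_sym -xf adjoint_shiftE yW linear0r rmorph0.
apply: (dot_ext f_basis) => x; rewrite -adjoint_shiftE linearZr_LR/= dot_shift_f0.
by rewrite mulr0 linear0r.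
Qed.

Lemma shimorin_space_f0 : shimorin_space dot T (f 0%N).
Proof. by apply/shimorin_spaceP; rewrite (dot_basis f_basis) scale1r. Qed.

Lemma ortho_proj_shimorin_space x :
  ortho_proj dot (shimorin_space dot T) x = dot x (f 0%N) *: f 0%N.
Proof.
set W := shimorin_space dot T.
have ex : exists u, W u /\ forall v, W v -> dot (x - u) v = 0.
  exists (dot x (f 0%N) *: f 0%N); split.
    by apply/shimorin_spaceP; rewrite linearZl_LR/= (dot_basis f_basis) mulr1.
  move=> v /shimorin_spaceP ->; rewrite linearZr_LR/= linearBl/= linearZl_LR/=.
  by rewrite (dot_basis f_basis) mulr1 subrr mulr0.
have [/shimorin_spaceP uW /(_ _ shimorin_space_f0)] := xgetPex (0 : H) ex.
rewrite -/(ortho_proj dot W x) linearBl/= => /eqP; rewrite subr_eq0 => /eqP ->.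
exact: uW.
Qed.

Local Notation L := (shimorin_inverse dot T).

(** Let [P] be the projection on the orthogonal complement of [f 0], and [B] the
    backward shift.  Then [T (B (P x)) = P x], which differs from [x] by an element
    of the kernel of [T^*]; hence [B (P x)] solves the equation [T^* T z = T^* x]
    that defines [L x], and the solution is unique because [T] is injective. *)
Lemma shimorin_inverse_spec : (exists M, bounded_linear L M) /\
  forall x n, taylor (L x) n = taylor (x - dot x (f 0%N) *: f 0%N) n.+1.
Proof.
have [B [[M BM] BP]] := backward_shift.
pose P x := x - dot x (f 0%N) *: f 0%N.
suff -> : L = B \o P.
  split; last by move=> x n; rewrite /= BP.
  exists (M * 2); split=> [|c x y|x] /=; first by rewrite mulr_ge0 ?(bl_ge0 BM).
    rewrite -(bl_linear BM) /P linearPl/= scalerDl -scalerA opprD scalerBr.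
    by rewrite -!addrA; congr (B (_ + _)); rewrite addrCA.
  rewrite (le_trans (bl_bound BM _))// -mulrA ler_wpM2l ?(bl_ge0 BM)//.
  rewrite (le_trans (ler_rnormD _ _))// rnormN rnormZ.
  have := dot_CauchySchwarz dot_norm x (f 0%N).
  by rewrite (rnorm_basis dot_norm f_basis); lra.
apply/funext => x.
have TB : T (B (P x)) = P x.
  apply: (taylor_inj ats) => -[|n]; rewrite taylor_shift ?BP//.
  by rewrite taylorB taylorZ (taylor_basis ats) eqxx /taylor; ring.
have ex : (adjoint dot T \o T) (B (P x)) = adjoint dot T x.
  rewrite /= TB; apply: (dot_ext f_basis) => z; rewrite -!adjoint_shiftE.
  by rewrite linearBr/= linearZr_LR/= dot_shift_f0 mulr0 subr0.
have := xgetPex (0 : H) (ex_intro [set z | (adjoint dot T \o T) z = adjoint dot T x] _ ex).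
rewrite -/(op_inv _ _) -[op_inv _ _]/(L x) => Lx.
have [N TN] := shift_bl.
have T0 : T (L x - B (P x)) = 0.
  apply/eqP; rewrite -(dnorm_eq0 dot) adjoint_shiftE.
  have [K AK] : exists K, bounded_linear (adjoint dot T) K.
    by exists N; exact: (adjoint_bounded dot_norm f_basis TN).
  by rewrite (blB TN) (blB AK) (Lx : adjoint dot T (T (L x)) = _) -ex subrr linear0r.
apply/eqP; rewrite -subr_eq0; apply/eqP; apply: (taylor_inj ats) => n.
have := taylor_shift (L x - B (P x)) n.+1; rewrite T0 => <-.
by rewrite /taylor !linear0l !mulr0; case: n => [|n]; rewrite ?linear0l ?mulr0.
Qed.

End Shift.

(** * The Shimorin kernel *)

Section ShimorinKernel.
Context {R : realType} {H : completeNormedModType R[i]}.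
Variables (dot : {dot H for Num.conj}) (ev : H -> R[i] -> R[i]).
Variables (k : R[i] -> R[i] -> R[i]) (a b : nat -> R[i]) (f : nat -> H).
Hypothesis ats : analytic_tridiagonal_space dot ev k a b f.

Let sat := ats.1.
Let dot_norm := rkhs_norm (sat_rkhs sat).
Let f_basis := sat_basis sat.
Let a_neq0 := sat_a_neq0 sat.

Local Notation taylor := (taylor dot a b f).
Local Notation T := (shift_op ev).
Local Notation L := (shimorin_inverse dot T).
Local Notation L' := (adjoint dot L).
Local Notation f0 := (f 0%N).
Local Notation beta := (b 0%N / a 0%N).

Let L_bl := (shimorin_inverse_spec ats).1.
Let taylor_L := (shimorin_inverse_spec ats).2.

(** The compression of [L ^ m L'^ n] to the line of [f 0], as a scalar. *)
Definition kernel_coef m n : R[i] := dot (iter m L (iter n L' f0)) f0.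

(** Measures how far the shift is from a weighted shift, see [weighted_shiftP]. *)
Definition defect j : R[i] := b j - beta * a j.

Lemma iter_adjoint_LE n g : dot g (iter n L' f0) = dot (iter n L g) f0.
Proof. by have [M LM] := L_bl; rewrite (iter_adjointE dot_norm f_basis LM). Qed.

Lemma taylor_LS x n : taylor (L x) n.+1 = taylor x n.+2.
Proof. by rewrite taylor_L taylorB taylorZ (taylor_basis ats) mulr0 subr0. Qed.

Lemma taylor_iter_LS m x n : taylor (iter m L x) n.+1 = taylor x (m + n).+1.
Proof. by elim: m n => //= m IH n; rewrite taylor_LS IH addnS. Qed.

Lemma taylor0E x : taylor x 0%N = a 0%N * dot x f0.
Proof. by rewrite /taylor addr0. Qed.

Lemma iter_L_0 x : a 0%N * dot (iter 0 L x) f0 = taylor x 0%N.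
Proof. by rewrite taylor0E. Qed.

(** [L] subtracts [dot y f0 *: f0] from [y := iter m L x] before it shifts, and the
    first Taylor coefficient of [f0] is [b 0]. *)
Lemma iter_L_S m x : a 0%N * dot (iter m.+1 L x) f0 =
  taylor x m.+1 - beta * (a 0%N * dot (iter m L x) f0).
Proof.
rewrite -!taylor0E /= taylor_L taylorB taylorZ taylor_iter_LS addn0 (taylor_basis ats)/=.
by rewrite taylor0E; have := a_neq0 0%N => a0; field.
Qed.

(** The term [b J * dot x (f J)] of the Taylor coefficient of rank [J.+1] cancels
    against the term in [beta] of [iter_L_S]. *)
Lemma iter_L_diag J : (forall j, (j < J)%N -> defect j = 0) ->
  forall x, a 0%N * dot (iter J L x) f0 = a J * dot x (f J).
Proof.
elim: J => [|J IH] dJ x; first by [].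
rewrite iter_L_S IH => [|j jJ]; last exact: dJ (ltnW jJ).
move/eqP: (dJ J (leqnn _)); rewrite /defect subr_eq0 => /eqP bJ.
by rewrite /taylor bJ; ring.
Qed.

Lemma kernel_coef_diag : (forall j, defect j = 0) ->
  forall m n, m != n -> kernel_coef m n = 0.
Proof.
move=> d0 m n mn; apply: (mulfI (a_neq0 0%N)).
rewrite /kernel_coef iter_L_diag// mulr0 (dot_sym _ _ (f m)) iter_adjoint_LE.
suff -> : dot (iter n L (f m)) f0 = 0 by rewrite rmorph0 mulr0.
apply: (mulfI (a_neq0 0%N)); rewrite iter_L_diag//.
by rewrite (dot_basis f_basis) (negPf mn) !mulr0.
Qed.

(** If [b 0] vanishes, then [a 0 * dot (iter i L x) f0] is a Taylor coefficient of
    [x], and so involves two adjacent coordinates only. *)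
Lemma kernel_coef_band : b 0%N = 0 ->
  forall m n, (2 <= `|m%:Z - n%:Z|)%N -> kernel_coef m n = 0.
Proof.
move=> b0 m n mn; have E i x : a 0%N * dot (iter i L x) f0 = taylor x i.
  by case: i => [|i]; [exact: iter_L_0|rewrite iter_L_S b0 !mul0r subr0].
have h0 j : n != j -> n != j.+1 -> dot (iter n L' f0) (f j) = 0.
  move=> nj nj1; rewrite dot_sym iter_adjoint_LE.
  suff -> : dot (iter n L (f j)) f0 = 0 by rewrite rmorph0.
  apply: (mulfI (a_neq0 0%N)); rewrite E (taylor_basis ats) (negPf nj) (negPf nj1).
  by rewrite mulr0.
apply: (mulfI (a_neq0 0%N)); rewrite /kernel_coef E /taylor mulr0.
rewrite h0 ?mulr0 ?add0r; [|by apply/eqP; lia|by apply/eqP; lia].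
by case: m mn => // m mn; rewrite h0 ?mulr0//; apply/eqP; lia.
Qed.

(** If the defects of index less than [j] vanish, then [iter_L_diag] turns
    [kernel_coef j j.+2 = 0] into [dot (iter j.+2 L (f j)) f0 = 0], while [iter_L_S]
    makes that number proportional to [beta * defect j]. *)
Lemma defect_eq0 : b 0%N != 0 ->
  (forall m n, (2 <= `|m%:Z - n%:Z|)%N -> kernel_coef m n = 0) ->
  forall j, defect j = 0.
Proof.
move=> b0 band j; have be0 : beta != 0 by rewrite mulf_neq0 ?invr_eq0.
elim/ltn_ind: j => j IH.
have : a 0%N * kernel_coef j j.+2 = 0.
  by rewrite band ?mulr0//; lia.
rewrite /kernel_coef (iter_L_diag IH) => /eqP; rewrite mulf_eq0 (negPf (a_neq0 _)) orFb.
rewrite dot_sym conjC_eq0 iter_adjoint_LE => /eqP d0.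
have : a 0%N * dot (iter j.+2 L (f j)) f0 = 0 by rewrite d0 mulr0.
rewrite !iter_L_S (iter_L_diag IH) !(taylor_basis ats) (dot_basis f_basis) !eqxx.
rewrite (gtn_eqF (leqnSn j.+1)) (gtn_eqF (leqnn j.+1)) (gtn_eqF (leqnn j.+2)) mulr1 sub0r.
by move/eqP; rewrite oppr_eq0 mulf_eq0 (negPf be0) => /eqP.
Qed.

(** Comparing Taylor coefficients, [T (f n)] is a multiple of [f n.+1] exactly when
    [b n / a n = b n.+1 / a n.+1]. *)
Lemma weighted_shiftP : is_weighted_shift f T <-> forall j, defect j = 0.
Proof.
have [_ tT] := shift_op_spec ats.
split=> [wT|d0 n].
  have step n : b n / a n = b n.+1 / a n.+1.
    have [c cE] := wT n.
    have h1 : a n = c * a n.+1.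
      by have := tT (f n) n.+1; rewrite cE taylorZ !(taylor_basis ats) !eqxx.
    have h2 : b n = c * b n.+1.
      have := tT (f n) n.+2; rewrite cE taylorZ !(taylor_basis ats) !eqxx.
      by rewrite !(gtn_eqF (leqnn _)).
    have c0 : c != 0 by apply: contra (a_neq0 n) => /eqP c0; rewrite h1 c0 mul0r.
    by rewrite h1 h2; have an := a_neq0 n.+1; field; rewrite an c0.
  move=> j; have : b j / a j = beta by elim: j => // j IH; rewrite -step.
  by rewrite /defect => <-; rewrite divfK ?subrr.
have bE j : b j = beta * a j by apply/eqP; rewrite -subr_eq0; apply/eqP; exact: d0.
exists (a n / a n.+1); apply: (taylor_inj ats) => m; rewrite tT taylorZ.
case: m => [|m]; rewrite !(taylor_basis ats)//= ?mulr0// !eqSS.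
case: eqP => _; first by rewrite divfK.
case: eqP => _; last by rewrite mulr0.
by rewrite (bE n) (bE n.+1) mulrCA divfK.
Qed.

Lemma rnorm_kernel_coef M : bounded_linear L M ->
  forall m n, rnorm (kernel_coef m n) <= M ^+ m * M ^+ n.
Proof.
move=> LM m n; rewrite (le_trans (dot_CauchySchwarz dot_norm _ _))//.
rewrite (rnorm_basis dot_norm f_basis) mulr1.
rewrite (le_trans (bl_bound (bl_iter LM m) _))// ler_wpM2l ?exprn_ge0 ?(bl_ge0 LM)//.
have L'M := adjoint_bounded dot_norm f_basis LM.
by rewrite (le_trans (bl_bound (bl_iter L'M n) _))// (rnorm_basis dot_norm f_basis) mulr1.
Qed.

(** With [M] a bound of [L], the radius [(4 * M)^-1] lies inside the disc of
    convergence of both Neumann series and bounds the terms of the double series by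
    the powers of [4^-1] that [unconditional_sum] requires. *)
Lemma shimorin_kernel_near0 : exists2 d : R, 0 < d &
  forall z w : R[i], rnorm z < d -> rnorm w < d ->
  [/\ shimorin_domain dot T z, shimorin_domain dot T w &
    exists2 K : R[i],
      (forall c, shimorin_kernel dot T z w (c *: f0) = (c * K) *: f0) &
      forall e : R, 0 < e -> exists F0 : {fset nat * nat}, forall F, (F0 `<=` F)%fset ->
        rnorm (K - \sum_(p <- F) z ^+ p.1 * Num.conj w ^+ p.2 * kernel_coef p.1 p.2) <= e].
Proof.
have [M0 LM0] := L_bl.
have [M [M_gt0 LM]] : exists M, 0 < M /\ bounded_linear L M.
  exists (M0 + 1); have h := bl_ge0 LM0; split; first lra.
  split; [lra|exact: bl_linear LM0|] => x.
  by rewrite (le_trans (bl_bound LM0 x))// ler_wpM2r ?rnorm_ge0// lerDl.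
have L'M := adjoint_bounded dot_norm f_basis LM.
have d_gt0 : 0 < (4 * M)^-1 by rewrite invr_gt0 mulr_gt0.
exists (4 * M)^-1 => // z w zd wd.
have f0_neq0 : f0 != 0.
  apply/eqP => f00; have := rnorm_basis dot_norm f_basis 0%N; rewrite f00 rnorm0.
  by move/esym/eqP; rewrite oner_eq0.
have Lf0 : L f0 = 0.
  apply: (taylor_inj ats) => n; rewrite taylor_L (dot_basis f_basis) scale1r subrr.
  by rewrite -(scale0r f0) !taylorZ !mul0r.
have dom (u : R[i]) : rnorm u < (4 * M)^-1 -> shimorin_domain dot T u.
  move=> ud; apply: (spectral_radius_inv_gt LM M_gt0 f0_neq0 Lf0).
  rewrite (lt_le_trans ud)// lef_pV2 ?posrE ?mulr_gt0// ler_wpM2r ?(ltW M_gt0)//.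
  by rewrite ler_nat.
have small (u : R[i]) : rnorm u < (4 * M)^-1 -> rnorm u * M <= 4^-1.
  move=> ud; rewrite -ler_pdivlMr// -invfM; exact: ltW.
have q42 : (4^-1 : R) <= 2^-1 by rewrite lef_pV2 ?posrE// ler_nat.
have zM := le_trans (small _ zd) q42.
have wM : rnorm (Num.conj w) * M <= 2^-1 by rewrite rnorm_conj (le_trans (small _ wd) q42).
split; [exact: dom|exact: dom|].
pose g := op_inv (fun x => x - Num.conj w *: L' x) f0.
have gE : g - Num.conj w *: L' g = f0 := op_inv_neumannK L'M wM f0.
pose h := op_inv (fun x => x - z *: L x) g.
have hE : h - z *: L h = g := op_inv_neumannK LM zM g.
exists (dot h f0) => [c|].
  rewrite /shimorin_kernel /= (ortho_proj_shimorin_space ats).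
  have -> : op_inv (fun x => x - Num.conj w *: L' x) (c *: f0) = c *: g.
    apply: (neumann_unique L'M wM); rewrite (op_inv_neumannK L'M wM).
    by rewrite (blZ L'M) scalerA mulrC -scalerA -scalerBr gE.
  have -> : op_inv (fun x => x - z *: L x) (c *: g) = c *: h.
    apply: (neumann_unique LM zM); rewrite (op_inv_neumannK LM zM).
    by rewrite (blZ LM) scalerA mulrC -scalerA -scalerBr hE.
  by rewrite linearZl_LR.
have gn : rnorm g <= 2.
  have := neumann_bound L'M wM g; rewrite gE (rnorm_basis dot_norm f_basis); lra.
have hn : rnorm h <= 4 by have := neumann_bound LM zM h; rewrite hE; lra.
have le0 N : 0 <= (2^-1 : R) ^+ N by rewrite exprn_ge0// invr_ge0.
apply: (@unconditional_sum _
  (fun p => z ^+ p.1 * Num.conj w ^+ p.2 * kernel_coef p.1 p.2) (dot h f0) 8) => // [p|N].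
  rewrite !rnormM !rnormX rnorm_conj.
  apply: (@le_trans _ _ ((rnorm z * M) ^+ p.1 * (rnorm w * M) ^+ p.2)).
    rewrite !exprMn mulrACA ler_wpM2l ?mulr_ge0 ?exprn_ge0 ?rnorm_ge0//.
    exact: rnorm_kernel_coef.
  have Mz (u : R[i]) : 0 <= rnorm u * M by rewrite mulr_ge0 ?rnorm_ge0 ?(ltW M_gt0).
  by rewrite ler_pM ?exprn_ge0// lerXn2r ?nnegrE ?invr_ge0 ?small.
pose G := \sum_(n < N) Num.conj w ^+ n *: iter n L' f0.
have GE : rnorm (g - G) <= 2^-1 ^+ N * 2.
  have := neumann_remainder L'M wM g N; rewrite gE -/G => h'.
  by rewrite (le_trans h')// ler_wpM2l.
pose S x := \sum_(m < N) z ^+ m *: iter m L x.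
have -> : \sum_(p <- square N)
    z ^+ p.1 * Num.conj w ^+ p.2 * kernel_coef p.1 p.2 = dot (S G) f0.
  rewrite (sum_square N
    (fun p => z ^+ p.1 * Num.conj w ^+ p.2 * kernel_coef p.1 p.2))/=.
  rewrite linear_sumlz; apply: eq_bigr => m _; rewrite linearZl_LR/=.
  have -> : iter m L G = \sum_(n < N) Num.conj w ^+ n *: iter m L (iter n L' f0).
    rewrite /G; elim/big_ind2: _ => [|x x' y y' <- <-|n _].
    - exact: bl0 (bl_iter LM m).
    - exact: blD (bl_iter LM m) _ _.
    - exact: blZ (bl_iter LM m) _ _.
  rewrite linear_sumlz mulr_sumr; apply: eq_bigr => n _.
  by rewrite [in RHS]linearZl_LR/= mulrA.
have SB x : rnorm (S x) <= 2 * rnorm x.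
  rewrite (le_trans (ler_rnorm_sum _ _ _))//.
  apply: (@le_trans _ _ (\sum_(m < N) 2^-1 ^+ m * rnorm x)); last first.
    by rewrite -mulr_suml ler_wpM2r ?rnorm_ge0// sum_half_le.
  apply: ler_sum => m _; rewrite rnormZ rnormX.
  rewrite (le_trans (ler_wpM2l _ (bl_bound (bl_iter LM m) x))) ?exprn_ge0 ?rnorm_ge0//.
  rewrite mulrA -exprMn ler_wpM2r ?rnorm_ge0// lerXn2r ?nnegrE ?invr_ge0//.
  by rewrite mulr_ge0 ?rnorm_ge0 ?(ltW M_gt0).
have hS : rnorm (h - S g) <= 2^-1 ^+ N * 4.
  have := neumann_remainder LM zM h N; rewrite hE -/(S g) => h'.
  by rewrite (le_trans h')// ler_wpM2l.
have SB' : S g - S G = S (g - G).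
  rewrite /S -sumrB; apply: eq_bigr => m _; rewrite -scalerBr.
  by rewrite (blB (bl_iter LM m)).
rewrite -linearBl/= (le_trans (dot_CauchySchwarz dot_norm _ _))//.
rewrite (rnorm_basis dot_norm f_basis) mulr1.
rewrite (le_trans (ler_rdistD (S g) _ _))// SB'.
have := SB (g - G); lra.
Qed.

(** The operators [C m n] may be replaced by the scalars [dot (C m n f0) f0]; their
    double power series has the same sum as that of the [kernel_coef m n]. *)
Lemma kernel_expansion_coef (C : nat -> nat -> H -> H) :
  kernel_expansion (shimorin_space dot T) (shimorin_domain dot T)
    (shimorin_kernel dot T) C ->
  forall m n, dot (C m n f0) f0 = kernel_coef m n.
Proof.
move=> [_ [d' /posc_real[d d_gt0 ->] Cexp]] m n.
have [dK dK_gt0 KP] := shimorin_kernel_near0.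
apply/eqP; rewrite -subr_eq0; apply/eqP.
pose D p := dot (C p.1 p.2 f0) f0 - kernel_coef p.1 p.2.
rewrite -[LHS]/(D (m, n)).
have dm : 0 < Num.min d dK by rewrite lt_min d_gt0.
apply: (double_series_unique dm) => z w /andP[z0]; rewrite lt_min => /andP[zd zdK].
move=> /andP[w0]; rewrite lt_min => /andP[wd wdK] e e_gt0.
have nz : rnorm (real_complex R z) = z by rewrite rnorm_real// ltW.
have nw : rnorm (real_complex R w) = w by rewrite rnorm_real// ltW.
have [||_ _ [K KE KF]] := KP (real_complex R z) (real_complex R w); rewrite ?nz ?nw//.
have [||_ _ CF] := Cexp (real_complex R z) (real_complex R w); rewrite ?rnormE ?nz ?nw ?ltcR//.
have e2 : 0 < e / 2 by rewrite divr_gt0.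
have [F1 F1P] := KF _ e2.
have [|F2 _ F2P] := CF (real_complex R (e / 2)); first by rewrite ltcR.
exists (F1 `|` F2)%fset => F; rewrite fsubUset => /andP[/F1P h1 /F2P /= h2].
have {h2} := h2 _ (shimorin_space_f0 ats).
rewrite -[f0 in shimorin_kernel _ _ _ _ f0]scale1r KE mul1r partial_sumE.
rewrite !rnormE -rmorphM lecR (rnorm_basis dot_norm f_basis) mulr1.
set Y := K *: f0 - _ => h2.
have h3 : rnorm (dot Y f0) <= e / 2.
  rewrite (le_trans (dot_CauchySchwarz dot_norm _ _))//.
  by rewrite (rnorm_basis dot_norm f_basis) mulr1.
have conjw : Num.conj (real_complex R w) = real_complex R w.
  by apply: CrealP; rewrite complex_real.
have YE : dot Y f0 = K -
    \sum_(p <- F) real_complex R (z ^+ p.1 * w ^+ p.2) * dot (C p.1 p.2 f0) f0.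
  rewrite /Y linearBl/= linearZl_LR/= (dot_basis f_basis) mulr1 linear_sumlz/=.
  congr (_ - _); apply: eq_bigr => p _.
  by rewrite linearZl_LR/= conjw rmorphM !rmorphXn.
have -> : \sum_(p <- F) real_complex R (z ^+ p.1 * w ^+ p.2) * D p =
    (K - \sum_(p <- F) real_complex R z ^+ p.1 * Num.conj (real_complex R w) ^+ p.2 *
           kernel_coef p.1 p.2) - dot Y f0.
  rewrite YE opprB addrCA addrAC subrr add0r -sumrB; apply: eq_bigr => p _.
  by rewrite /D conjw rmorphM !rmorphXn mulrBr.
rewrite (le_trans (ler_rnormD _ _))// rnormN; lra.
Qed.

Lemma kernel_coef_expansion :
  kernel_expansion (shimorin_space dot T) (shimorin_domain dot T)
    (shimorin_kernel dot T) (fun m n x => kernel_coef m n *: x).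
Proof.
split=> [m n|].
  split=> [x /(shimorin_spaceP ats) xW|c x y _ _|].
  - by apply/(shimorin_spaceP ats); rewrite {1}xW linearZl_LR/= scalerA.
  - by rewrite scalerDr !scalerA mulrC.
  - by exists `|kernel_coef m n| => x _; rewrite normrZ.
have [d d_gt0 KP] := shimorin_kernel_near0.
exists (real_complex R d) => [|z w]; first by rewrite ltcR.
rewrite !rnormE !ltcR => zd wd; have [Oz Ow [K KE KF]] := KP z w zd wd.
split=> // _ /posc_real[e e_gt0 ->]; have [F0 F0P] := KF e e_gt0.
exists F0 => // F /= /F0P KS x /(shimorin_spaceP ats) xW.
rewrite !rnormE -rmorphM lecR partial_sumE xW KE.
have -> : \sum_(p <- F) (z ^+ p.1 * Num.conj w ^+ p.2) *:
    (kernel_coef p.1 p.2 *: (dot x f0 *: f0)) =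
  (dot x f0 *
   \sum_(p <- F) z ^+ p.1 * Num.conj w ^+ p.2 * kernel_coef p.1 p.2) *: f0.
  rewrite mulr_sumr scaler_suml; apply: eq_bigr => p _.
  by rewrite !scalerA; congr (_ *: _); ring.
rewrite -scalerBl -mulrBr !rnormZ rnormM !(rnorm_basis dot_norm f_basis) !mulr1.
by rewrite [leLHS]mulrC ler_wpM2r ?rnorm_ge0.
Qed.

Lemma tridiagonal_kernelP :
  tridiagonal_kernel (shimorin_space dot T) (shimorin_domain dot T) (shimorin_kernel dot T) <->
  forall m n, (2 <= `|m%:Z - n%:Z|)%N -> kernel_coef m n = 0.
Proof.
split=> [[C CE C0] m n mn|X0].
  by rewrite -(kernel_expansion_coef CE) C0 ?linear0l//; exact: shimorin_space_f0 ats.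
exists (fun m n x => kernel_coef m n *: x); first exact: kernel_coef_expansion.
by move=> m n mn x _; rewrite X0// scale0r.
Qed.

End ShimorinKernel.

Theorem theorem4p2 (R : realType) (H : completeNormedModType R[i])
    (dot : {dot H for Num.conj}) (ev : H -> R[i] -> R[i])
    (k : R[i] -> R[i] -> R[i]) (a b : nat -> R[i]) (f : nat -> H) :
  analytic_tridiagonal_space dot ev k a b f ->
  tridiagonal_kernel (shimorin_space dot (shift_op ev))
    (shimorin_domain dot (shift_op ev)) (shimorin_kernel dot (shift_op ev))
  <-> (is_weighted_shift f (shift_op ev) \/ b 0%N = 0).
Proof.
move=> ats; rewrite (tridiagonal_kernelP ats) (weighted_shiftP ats).
split=> [band|[d0|b0]].
- have [b0|b0] := eqVneq (b 0%N) 0; first by right.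
  by left; exact: (defect_eq0 ats b0 band).
- by move=> m n mn; apply: (kernel_coef_diag ats d0); apply/eqP; lia.
- exact: (kernel_coef_band ats b0).
Qed.
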